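(* Let $X$ be a separable Hilbert space, $\Lambda\subset\mathbb{N}$ an infinite lacunary set, $m_1,\dots,m_d\in\mathbb{Z}$ fixed integers, and $f=(f_i)_{1\le i\le d}\in H^2(\mathbb{D},X^d)$ with $\sigma(f_i)\subset\Lambda+m_i$ for each $i$. Suppose the sequence $\big(\hat f_1(k+m_1),\hat f_2(k+m_2),\dots,\hat f_d(k+m_d)\big)_{k\ge0}$ is completely relatively compact in $X^d$. Then $f$ is cyclic for $S^*$ if and only if for every $N\ge0$, $$\operatorname{span}\big\{\big(\hat f_1(k+m_1),\dots,\hat f_d(k+m_d)\big): k\ge N\big\}=X^d.$$
   Context: $H^2(\mathbb{D},Y)$: $Y$-valued power series with square-summable coefficient norms; $X^d$ the Hilbert direct sum of $d$ copies of $X$; coordinates $f_i\in H^2(\mathbb{D},X)$; $\hat f_i(j)=0$ for $j<0$ by convention. $\sigma(g)=\{k:\hat g(k)\ne0\}$; $\Lambda+m=\{\lambda+m:\lambda\in\Lambda\}$. Lacunary: $n_{k+1}/n_k\ge c>1$. $S^*$ the backward shift; cyclic means the closed span of $\{S^{*n}f\}$ is the whole space; span is closed linear span. Completely relatively compact: for every orthogonal projection $P$, $(Pa_k/\|Pa_k\|)_{Pa_k\ne0}$ is relatively compact. *)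

(* Defs.v *)
From Stdlib Require Import Reals Lra ZArith.
From Stdlib Require Fin.
Open Scope R_scope.

Record C := mkC { Cre : R; Cim : R }.
Definition C0 : C := mkC 0 0.
Definition C1 : C := mkC 1 0.
Definition CR (r : R) : C := mkC r 0.
Definition Cadd (a b : C) : C := mkC (Cre a + Cre b) (Cim a + Cim b).
Definition Cmul (a b : C) : C :=
  mkC (Cre a * Cre b - Cim a * Cim b) (Cre a * Cim b + Cim a * Cre b).
Definition Copp (a : C) : C := mkC (- Cre a) (- Cim a).
Definition Cconj (a : C) : C := mkC (Cre a) (- Cim a).

Record IPS := mkIPS {
  carrier :> Type;
  vzero : carrier;
  vadd : carrier -> carrier -> carrier;
  vscal : C -> carrier -> carrier;
  vinner : carrier -> carrier -> C   (* linear in the first argument *)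
}.
Arguments vzero {_}. Arguments vadd {_}. Arguments vscal {_}. Arguments vinner {_}.

Definition vsub {V : IPS} (x y : V) : V := vadd x (vscal (Copp C1) y).
Definition vnorm {V : IPS} (x : V) : R := sqrt (Cre (vinner x x)).

Fixpoint vsum {V : IPS} (N : nat) (g : nat -> V) : V :=
  match N with
  | O => vzero
  | S N' => vadd (vsum N' g) (g N')
  end.

Definition is_hilbert (V : IPS) : Prop :=
  (forall x y z : V, vadd x (vadd y z) = vadd (vadd x y) z) /\
  (forall x y : V, vadd x y = vadd y x) /\
  (forall x : V, vadd x vzero = x) /\
  (forall x : V, vadd x (vscal (Copp C1) x) = vzero) /\
  (forall x : V, vscal C1 x = x) /\
  (forall (a b : C) (x : V), vscal (Cmul a b) x = vscal a (vscal b x)) /\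
  (forall (a : C) (x y : V), vscal a (vadd x y) = vadd (vscal a x) (vscal a y)) /\
  (forall (a b : C) (x : V), vscal (Cadd a b) x = vadd (vscal a x) (vscal b x)) /\
  (forall x y z : V, vinner (vadd x y) z = Cadd (vinner x z) (vinner y z)) /\
  (forall (a : C) (x y : V), vinner (vscal a x) y = Cmul a (vinner x y)) /\
  (forall x y : V, vinner y x = Cconj (vinner x y)) /\
  (forall x : V, 0 <= Cre (vinner x x)) /\
  (forall x : V, vinner x x = C0 -> x = vzero) /\
  (forall u : nat -> V,
     (forall eps, eps > 0 -> exists N, forall n m, (n >= N)%nat -> (m >= N)%nat ->
        vnorm (vsub (u n) (u m)) < eps) ->
     exists l : V, Un_cv (fun n => vnorm (vsub (u n) l)) 0).

Definition separable (V : IPS) : Prop :=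
  exists D : nat -> V, forall (x : V) eps, eps > 0 ->
    exists n, vnorm (vsub x (D n)) < eps.

Fixpoint finsum (n : nat) : (Fin.t n -> C) -> C :=
  match n with
  | O => fun _ => C0
  | S n' => fun g => Cadd (g Fin.F1) (finsum n' (fun i => g (Fin.FS i)))
  end.

Definition powIPS (X : IPS) (d : nat) : IPS :=
  mkIPS (Fin.t d -> X)
        (fun _ => vzero)
        (fun u v i => vadd (u i) (v i))
        (fun a u i => vscal a (u i))
        (fun u v => finsum d (fun i => vinner (u i) (v i))).

Definition is_orth_proj {V : IPS} (P : V -> V) : Prop :=
  (forall x y : V, P (vadd x y) = vadd (P x) (P y)) /\
  (forall (a : C) (x : V), P (vscal a x) = vscal a (P x)) /\
  (forall x : V, P (P x) = P x) /\
  (forall x y : V, vinner (P x) y = vinner x (P y)).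

(** A set is relatively compact: every sequence in it has a subsequence
    converging in V (metric space: closure sequentially compact). *)
Definition rel_compact {V : IPS} (A : V -> Prop) : Prop :=
  forall u : nat -> V, (forall n, A (u n)) ->
    exists (phi : nat -> nat) (l : V),
      (forall n, (phi n < phi (S n))%nat) /\
      Un_cv (fun n => vnorm (vsub (u (phi n)) l)) 0.

Definition completely_rel_compact {V : IPS} (a : nat -> V) : Prop :=
  forall P : V -> V, is_orth_proj P ->
    rel_compact (fun y : V => exists k,
      P (a k) <> vzero /\ y = vscal (CR (/ vnorm (P (a k)))) (P (a k))).

Definition span_tail_full {V : IPS} (a : nat -> V) (N : nat) : Prop :=
  forall (y : V) eps, eps > 0 ->
    exists (M : nat) (c : nat -> C),
      vnorm (vsub y (vsum M (fun j => vscal (c j) (a (N + j)%nat)))) < eps.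

(** * H^2(D, V): sequences of Taylor coefficients, square summable *)
Definition in_H2 {V : IPS} (F : nat -> V) : Prop :=
  exists s, infinite_sum (fun k => (vnorm (F k)) ^ 2) s.

Definition H2_dist_lt {V : IPS} (F G : nat -> V) (eps : R) : Prop :=
  exists s, infinite_sum (fun k => (vnorm (vsub (F k) (G k))) ^ 2) s /\ s < eps ^ 2.

Definition bshift_iter {V : IPS} (n : nat) (F : nat -> V) : nat -> V :=
  fun k => F (k + n)%nat.

Definition cyclic_bshift {V : IPS} (F : nat -> V) : Prop :=
  forall G : nat -> V, in_H2 G -> forall eps, eps > 0 ->
    exists (N : nat) (c : nat -> C),
      H2_dist_lt G (fun k => vsum N (fun n => vscal (c n) (bshift_iter n F k))) eps.

Definition lacunary_infinite (Lam : nat -> Prop) : Prop :=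
  exists (n : nat -> nat) (c : R),
    (forall k, (n k < n (S k))%nat) /\
    (forall x, Lam x <-> exists k, x = n k) /\
    c > 1 /\ (forall k, INR (n (S k)) >= c * INR (n k)).

Definition fhat {X : IPS} (g : nat -> X) (j : Z) : X :=
  if (j <? 0)%Z then vzero else g (Z.to_nat j).

Definition spec_in_shift {X : IPS} (g : nat -> X) (Lam : nat -> Prop) (m : Z) : Prop :=
  forall j : nat, g j <> vzero -> exists l, Lam l /\ Z.of_nat j = (Z.of_nat l + m)%Z.

(* Main.v *)
(** If every tail of the vectors [a_k = (f_i^(k + m_i))_i] spans and [h] is orthogonal to all
    backward shifts of [f], shift the coordinates of [h] so that
    [sum_s <a_(s+n), h_s> = 0] for all [n].  Let [P] be the orthogonal projection onto the closed
    span of the [h_p].  Compactness of the normalized [P a_k] gives [eps] and finitely many [p]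
    with [|<a_k, h_p>| >= eps |P a_k|] for one of them.  For [k] in the lacunary set, taking
    [n = k - p] isolates the term [<a_k, h_p>], and Cauchy-Schwarz yields
    [eps^2 |P a_k|^2 <= (sum_(j > k) |P a_j|^2) * (sum_(q >= 1, k + q in Lam) |h_(p+q)|^2)].
    Each [q] is a difference of two elements of [Lam] in a bounded number of ways, so the second
    factor is summable over [k] in [Lam].  Hence [P a_k = 0] for large [k]; the tails of [a] being
    total, all [h_p] vanish.

    Conversely, approximating the function with coordinates [y_i z^(M + m_i)] by combinations of
    backward shifts and reading off the coefficients of order [M + m_i] approximates [y] by
    combinations of the [a_k] with [k >= M]. *)

From Stdlib Require Import Reals Lra Lia ZArith.
From Stdlib Require Import Classical ClassicalEpsilon FunctionalExtensionality ProofIrrelevance.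
From Stdlib Require Fin.
From Coquelicot Require Import Rbar Hierarchy Lim_seq Series.
Require Import Defs.
Open Scope R_scope.

Existing Class is_hilbert.
#[local] Hint Mode is_hilbert ! : typeclass_instances.

(** * Complex scalars *)

Lemma C_ext (a b : C) : Cre a = Cre b -> Cim a = Cim b -> a = b.
Proof. destruct a, b; simpl; intros -> ->; reflexivity. Qed.

Ltac Cring := apply C_ext; simpl; ring.

Definition Cmod (z : C) : R := sqrt (Cre z ^ 2 + Cim z ^ 2).

Lemma Cmod_ge0 (z : C) : 0 <= Cmod z.
Proof. apply sqrt_pos. Qed.

Lemma Cmod_sqr (z : C) : Cmod z ^ 2 = Cre z ^ 2 + Cim z ^ 2.
Proof. apply pow2_sqrt. nra. Qed.

Lemma Cmod_CR (r : R) : Cmod (CR r) = Rabs r.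
Proof. rewrite <- sqrt_Rsqr_abs. unfold Cmod, Rsqr. f_equal. simpl. ring. Qed.

Lemma Cmod_C0 : Cmod C0 = 0.
Proof. exact (eq_trans (Cmod_CR 0) Rabs_R0). Qed.

Lemma Cmod_mul (a b : C) : Cmod (Cmul a b) = Cmod a * Cmod b.
Proof. unfold Cmod. rewrite <- sqrt_mult_alt by nra. f_equal. simpl. ring. Qed.

Lemma Cmod_eq0 (z : C) : Cmod z = 0 -> z = C0.
Proof. intros E. pose proof (Cmod_sqr z) as sqr. rewrite E in sqr. apply C_ext; simpl; nra. Qed.

Lemma Cre_abs_le (z : C) : Rabs (Cre z) <= Cmod z.
Proof. rewrite <- sqrt_Rsqr_abs. apply sqrt_le_1_alt. unfold Rsqr. nra. Qed.

Lemma Cim_abs_le (z : C) : Rabs (Cim z) <= Cmod z.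
Proof. rewrite <- sqrt_Rsqr_abs. apply sqrt_le_1_alt. unfold Rsqr. nra. Qed.

Lemma Cmod_phase (z : C) : exists w, Cmod w = 1 /\ Cre (Cmul w z) = Cmod z.
Proof.
  destruct (Req_dec (Cmod z) 0) as [E | E].
  - exists C1. rewrite (Cmod_eq0 z E), Cmod_C0. split; [| simpl; ring].
    exact (eq_trans (Cmod_CR 1) Rabs_R1).
  - exists (mkC (Cre z / Cmod z) (- Cim z / Cmod z)). pose proof (Cmod_sqr z) as sqr. split.
    + transitivity (sqrt 1); [unfold Cmod at 1; f_equal; simpl Cre; simpl Cim | apply sqrt_1].
      transitivity ((Cre z ^ 2 + Cim z ^ 2) / Cmod z ^ 2); [field; exact E |].
      rewrite <- sqr. field. exact E.
    + simpl. apply (Rmult_eq_reg_r (Cmod z)); [| exact E].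
      transitivity (Cre z ^ 2 + Cim z ^ 2); [field; exact E | rewrite <- sqr; ring].
Qed.

Lemma is_lim_seq_Cmod (z : nat -> C) (l : C) :
  is_lim_seq (fun n => Cre (z n)) (Cre l) -> is_lim_seq (fun n => Cim (z n)) (Cim l) ->
  is_lim_seq (fun n => Cmod (z n)) (Cmod l).
Proof.
  intros Hre Him. apply (is_lim_seq_continuous sqrt); [apply continuity_pt_sqrt; nra |].
  simpl. apply is_lim_seq_plus'; repeat apply is_lim_seq_mult';
    auto using is_lim_seq_const.
Qed.

(** * Inner products *)

Definition re_inner {V : IPS} (x y : V) : R := Cre (vinner x y).
Definition sqnorm {V : IPS} (x : V) : R := re_inner x x.

Section InnerProduct.
Context {V : IPS} {HV : is_hilbert V}.

Lemma inner_addl (x y z : V) : vinner (vadd x y) z = Cadd (vinner x z) (vinner y z).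
Proof. apply HV. Qed.

Lemma inner_scall a (x y : V) : vinner (vscal a x) y = Cmul a (vinner x y).
Proof. apply HV. Qed.

Lemma inner_sym (x y : V) : vinner y x = Cconj (vinner x y).
Proof. apply HV. Qed.

Lemma inner_addr (x y z : V) : vinner x (vadd y z) = Cadd (vinner x y) (vinner x z).
Proof.
  rewrite (inner_sym (vadd y z) x), (inner_sym y x), (inner_sym z x), inner_addl. Cring.
Qed.

Lemma inner_scalr a (x y : V) : vinner x (vscal a y) = Cmul (Cconj a) (vinner x y).
Proof. rewrite (inner_sym (vscal a y) x), (inner_sym y x), inner_scall. Cring. Qed.

Lemma inner_zerol (y : V) : vinner vzero y = C0.
Proof.
  assert (sum0 : vadd vzero (vscal (Copp C1) vzero) = (vzero : V))
    by (destruct HV as (_ & _ & _ & addN & _); apply addN).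
  apply (f_equal (fun v => vinner v y)) in sum0. rewrite inner_addl, inner_scall in sum0.
  rewrite <- sum0. Cring.
Qed.

Lemma inner_zeror (x : V) : vinner x vzero = C0.
Proof. rewrite (inner_sym vzero x), inner_zerol. Cring. Qed.

Lemma inner_subl (x y z : V) :
  vinner (vsub x y) z = Cadd (vinner x z) (Copp (vinner y z)).
Proof. unfold vsub. rewrite inner_addl, inner_scall. Cring. Qed.

Lemma inner_self_eq (x : V) : vinner x x = CR (sqnorm x).
Proof.
  apply C_ext; [reflexivity |].
  pose proof (f_equal Cim (inner_sym x x)) as im_eq. simpl in *. lra.
Qed.

Lemma inner_orth_sym (x y : V) : vinner x y = C0 -> vinner y x = C0.
Proof. intros E. rewrite inner_sym, E. Cring. Qed.

Lemma sqnorm_ge0 (x : V) : 0 <= sqnorm x.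
Proof. apply HV. Qed.

Lemma sqnorm_zero : sqnorm (vzero : V) = 0.
Proof. unfold sqnorm, re_inner. rewrite inner_zerol. reflexivity. Qed.

Lemma sqnorm_eq0 (x : V) : sqnorm x = 0 -> x = vzero.
Proof.
  intros E. assert (definite : vinner x x = C0 -> x = vzero) by apply HV.
  apply definite. rewrite inner_self_eq, E. reflexivity.
Qed.

Lemma inner_self_eq0 (x : V) : vinner x x = C0 -> x = vzero.
Proof. intros E. apply sqnorm_eq0. exact (f_equal Cre E). Qed.

Lemma vsub_eq0 (x y : V) : vsub x y = vzero -> x = y.
Proof.
  destruct HV as (addA & addC & add0 & addN & _). intros E.
  transitivity (vadd x (vadd (vscal (Copp C1) y) y)).
  - rewrite (addC (vscal _ y) y), addN, add0. reflexivity.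
  - rewrite addA. unfold vsub in E. rewrite E, addC. apply add0.
Qed.

Lemma inner_ext (x y : V) : (forall z, vinner x z = vinner y z) -> x = y.
Proof.
  intros E. apply vsub_eq0, inner_self_eq0. rewrite inner_subl, E. Cring.
Qed.
End InnerProduct.

Ltac vring :=
  apply inner_ext; let z := fresh in intro z; unfold vsub;
  repeat first [rewrite inner_addl | rewrite inner_scall | rewrite inner_zerol];
  Cring.

Section Norm.
Context {V : IPS} {HV : is_hilbert V}.

Lemma re_inner_sym (x y : V) : re_inner y x = re_inner x y.
Proof. unfold re_inner. rewrite (inner_sym x y). reflexivity. Qed.

Lemma re_inner_CRl r (x y : V) : re_inner (vscal (CR r) x) y = r * re_inner x y.
Proof. unfold re_inner. rewrite inner_scall. simpl. ring. Qed.

Lemma re_inner_CRr r (x y : V) : re_inner x (vscal (CR r) y) = r * re_inner x y.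
Proof. rewrite (re_inner_sym _ x), re_inner_CRl, re_inner_sym. reflexivity. Qed.

Lemma re_inner_addl (x y z : V) : re_inner (vadd x y) z = re_inner x z + re_inner y z.
Proof. unfold re_inner. rewrite inner_addl. reflexivity. Qed.

Lemma re_inner_subl (x y z : V) : re_inner (vsub x y) z = re_inner x z - re_inner y z.
Proof. unfold re_inner. rewrite inner_subl. reflexivity. Qed.

Lemma re_inner_subr (x y z : V) : re_inner x (vsub y z) = re_inner x y - re_inner x z.
Proof. rewrite !(re_inner_sym _ x). apply re_inner_subl. Qed.

Lemma sqnorm_scal a (x : V) : sqnorm (vscal a x) = Cmod a ^ 2 * sqnorm x.
Proof.
  unfold sqnorm at 1, re_inner. rewrite inner_scall, inner_scalr, inner_self_eq, Cmod_sqr.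
  simpl. ring.
Qed.

Lemma sqnorm_CR r (x : V) : sqnorm (vscal (CR r) x) = r ^ 2 * sqnorm x.
Proof. rewrite sqnorm_scal, Cmod_CR, pow2_abs. reflexivity. Qed.

Lemma sqnorm_add (x y : V) : sqnorm (vadd x y) = sqnorm x + 2 * re_inner x y + sqnorm y.
Proof.
  unfold sqnorm. rewrite re_inner_addl, !(re_inner_sym (vadd x y)), !re_inner_addl,
    (re_inner_sym x y). ring.
Qed.

Lemma sqnorm_sub (x y : V) : sqnorm (vsub x y) = sqnorm x - 2 * re_inner x y + sqnorm y.
Proof.
  unfold sqnorm. rewrite re_inner_subl, !re_inner_subr, (re_inner_sym x y). ring.
Qed.

Lemma parallelogram (x y : V) :
  sqnorm (vadd x y) + sqnorm (vsub x y) = 2 * sqnorm x + 2 * sqnorm y.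
Proof. rewrite sqnorm_add, sqnorm_sub. ring. Qed.

Lemma sqnorm_sub_sym (x y : V) : sqnorm (vsub x y) = sqnorm (vsub y x).
Proof. rewrite !sqnorm_sub, (re_inner_sym x y). ring. Qed.

Lemma vnorm_ge0 (x : V) : 0 <= vnorm x.
Proof. apply sqrt_pos. Qed.

Lemma vnorm_sqr (x : V) : vnorm x ^ 2 = sqnorm x.
Proof. apply pow2_sqrt, sqnorm_ge0. Qed.

Lemma vnorm_zero : vnorm (vzero : V) = 0.
Proof. unfold vnorm. rewrite inner_zerol. apply sqrt_0. Qed.

Lemma vnorm_gt0 (x : V) : x <> vzero -> 0 < vnorm x.
Proof.
  intros nz. destruct (vnorm_ge0 x) as [pos | norm0]; [exact pos |].
  exfalso. apply nz, sqnorm_eq0. rewrite <- vnorm_sqr, <- norm0. ring.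
Qed.

Lemma vnorm_lt (x : V) e : 0 <= e -> sqnorm x < e ^ 2 -> vnorm x < e.
Proof.
  intros He H. rewrite <- (sqrt_pow2 e He).
  apply sqrt_lt_1_alt. split; [apply sqnorm_ge0 | exact H].
Qed.

Lemma sqnorm_lt (x : V) e : vnorm x < e -> sqnorm x < e ^ 2.
Proof. intros H. rewrite <- vnorm_sqr. pose proof (vnorm_ge0 x). nra. Qed.

Lemma vnorm_sub_sym (x y : V) : vnorm (vsub x y) = vnorm (vsub y x).
Proof. exact (f_equal sqrt (sqnorm_sub_sym x y)). Qed.

Lemma re_inner_sqr_le (x y : V) : re_inner x y ^ 2 <= sqnorm x * sqnorm y.
Proof.
  pose proof (sqnorm_ge0 (vsub (vscal (CR (sqnorm y)) x) (vscal (CR (re_inner x y)) y)))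
    as gram_ge0.
  rewrite sqnorm_sub, !sqnorm_CR, re_inner_CRl, re_inner_CRr in gram_ge0.
  pose proof (sqnorm_ge0 x). destruct (sqnorm_ge0 y) as [Hy | Hy]; [nra |].
  assert (y0 : y = vzero) by (apply sqnorm_eq0; auto).
  assert (re_inner x y = 0)
    by (unfold re_inner; rewrite y0, inner_zeror; reflexivity).
  nra.
Qed.

Lemma Cmod_inner_sqr_le (x y : V) : Cmod (vinner x y) ^ 2 <= sqnorm x * sqnorm y.
Proof.
  destruct (Cmod_phase (vinner x y)) as (w & Hw & E). rewrite <- inner_scall in E.
  rewrite <- E. eapply Rle_trans; [apply re_inner_sqr_le |]. rewrite sqnorm_scal, Hw. lra.
Qed.

Lemma Cmod_inner_le (x y : V) : Cmod (vinner x y) <= vnorm x * vnorm y.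
Proof.
  apply Rsqr_incr_0_var.
  - pose proof (Cmod_inner_sqr_le x y) as sqr_le. rewrite <- !vnorm_sqr in sqr_le. unfold Rsqr. nra.
  - apply Rmult_le_pos; apply vnorm_ge0.
Qed.
End Norm.

(** * Convergence *)

Lemma is_lim_seq_dominated (u e : nat -> R) (l : R) :
  (forall n, Rabs (u n - l) <= e n) -> is_lim_seq e 0 -> is_lim_seq u l.
Proof.
  intros H He.
  apply is_lim_seq_ext with (fun n => (u n - l) + l); [intros n; ring |].
  replace (Finite l) with (Finite (0 + l)) by (f_equal; ring).
  apply is_lim_seq_plus'; [| apply is_lim_seq_const].
  apply is_lim_seq_abs_0, is_lim_seq_le_le with (fun _ => 0) e; auto using is_lim_seq_const.
  intros n. split; [apply Rabs_pos | apply H].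
Qed.

Lemma is_lim_seq_const_eq (u : nat -> R) (a l : R) :
  (forall n, u n = a) -> is_lim_seq u l -> l = a.
Proof.
  intros E H. apply is_lim_seq_unique in H.
  rewrite (Lim_seq_ext _ _ E), Lim_seq_const in H. injection H. auto.
Qed.

Lemma is_lim_seq_inv_succ : is_lim_seq (fun n => / (INR n + 1)) 0.
Proof. exact (proj2 (is_lim_seq_Reals _ 0) RinvN_cv). Qed.

Lemma inv_succ_gt0 (n : nat) : 0 < / (INR n + 1).
Proof. exact (RinvN_pos n). Qed.

Lemma inv_succ_le (n m : nat) : (n <= m)%nat -> / (INR m + 1) <= / (INR n + 1).
Proof.
  intros H. apply Rinv_le_contravar; [pose proof (pos_INR n); lra |]. apply le_INR in H. lra.
Qed.

Definition vlim {V : IPS} (u : nat -> V) (l : V) : Prop :=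
  is_lim_seq (fun n => vnorm (vsub (u n) l)) 0.

Definition vcauchy {V : IPS} (u : nat -> V) : Prop :=
  forall eps, eps > 0 -> exists N, forall n m, (n >= N)%nat -> (m >= N)%nat ->
    vnorm (vsub (u n) (u m)) < eps.

Lemma vlim_of_sqnorm {V : IPS} (u : nat -> V) (l : V) :
  is_lim_seq (fun n => sqnorm (vsub (u n) l)) 0 -> vlim u l.
Proof.
  intros H. unfold vlim. rewrite <- sqrt_0.
  apply (is_lim_seq_continuous sqrt); [apply continuity_pt_sqrt; lra | exact H].
Qed.

Section Convergence.
Context {V : IPS} {HV : is_hilbert V}.

Lemma vlim_sqnorm_sub (u : nat -> V) l : vlim u l -> is_lim_seq (fun n => sqnorm (vsub (u n) l)) 0.
Proof.
  intros H. apply is_lim_seq_ext with (fun n => vnorm (vsub (u n) l) * vnorm (vsub (u n) l)).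
  { intros n. rewrite <- vnorm_sqr. ring. }
  replace 0 with (0 * 0) by ring. apply is_lim_seq_mult'; exact H.
Qed.

Lemma vlim_inner (u : nat -> V) l y : vlim u l ->
  is_lim_seq (fun n => Cre (vinner (u n) y)) (Cre (vinner l y)) /\
  is_lim_seq (fun n => Cim (vinner (u n) y)) (Cim (vinner l y)).
Proof.
  intros H.
  assert (bound_cvg : is_lim_seq (fun n => vnorm (vsub (u n) l) * vnorm y) 0).
  { replace 0 with (0 * vnorm y) by ring.
    apply is_lim_seq_mult'; [exact H | apply is_lim_seq_const]. }
  split; refine (is_lim_seq_dominated _ _ _ (fun n => _) bound_cvg);
    (eapply Rle_trans; [| apply (Cmod_inner_le (vsub (u n) l) y)]); rewrite inner_subl.
  - apply (Cre_abs_le (Cadd _ (Copp _))).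
  - apply (Cim_abs_le (Cadd _ (Copp _))).
Qed.

Lemma vlim_Cmod_inner (u : nat -> V) l y : vlim u l ->
  is_lim_seq (fun n => Cmod (vinner (u n) y)) (Cmod (vinner l y)).
Proof. intros H. apply is_lim_seq_Cmod; apply vlim_inner, H. Qed.

Lemma vlim_sqnorm (u : nat -> V) l : vlim u l -> is_lim_seq (fun n => sqnorm (u n)) (sqnorm l).
Proof.
  intros H.
  apply is_lim_seq_ext with (fun n => sqnorm (vsub (u n) l) + (2 * re_inner (u n) l - sqnorm l)).
  { intros n. rewrite sqnorm_sub. ring. }
  replace (Finite (sqnorm l)) with (Finite (0 + (2 * re_inner l l - sqnorm l)))
    by (unfold sqnorm; f_equal; ring).
  apply is_lim_seq_plus'; [apply vlim_sqnorm_sub, H |].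
  apply is_lim_seq_minus'; [| apply is_lim_seq_const].
  apply is_lim_seq_mult'; [apply is_lim_seq_const | apply vlim_inner, H].
Qed.

Lemma vlim_subl (u : nat -> V) l x : vlim u l -> vlim (fun n => vsub x (u n)) (vsub x l).
Proof.
  intros H. eapply is_lim_seq_ext; [| exact H].
  intros n. simpl. rewrite vnorm_sub_sym. f_equal. vring.
Qed.

Lemma cauchy_vlim (u : nat -> V) : vcauchy u -> exists l, vlim u l.
Proof.
  intros H. destruct HV as (_ & _ & _ & _ & _ & _ & _ & _ & _ & _ & _ & _ & _ & complete).
  destruct (complete u H) as [l Hl]. exists l. apply is_lim_seq_Reals, Hl.
Qed.

Lemma cauchy_vlim_coordinates {W : IPS} {I : Type} (u : nat -> W) (proj : I -> W -> V) :
  vcauchy u ->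
  (forall i n m, vnorm (vsub (proj i (u n)) (proj i (u m))) <= vnorm (vsub (u n) (u m))) ->
  exists l : I -> V, forall i, vlim (fun n => proj i (u n)) (l i).
Proof.
  intros Hu proj_le. apply (choice (fun i l => vlim (fun n => proj i (u n)) l)).
  intros i. apply cauchy_vlim. intros eps He. destruct (Hu eps He) as [N HN].
  exists N. intros n m Hn Hm. eapply Rle_lt_trans; [apply proj_le | apply HN; assumption].
Qed.

End Convergence.
(** * Orthogonal projections *)

Definition is_subspace {V : IPS} (E : V -> Prop) : Prop :=
  E vzero /\ (forall x y, E x -> E y -> E (vadd x y)) /\ (forall a x, E x -> E (vscal a x)).

Definition in_closure {V : IPS} (E : V -> Prop) (q : V) : Prop :=
  forall eps, eps > 0 -> exists e, E e /\ vnorm (vsub q e) < eps.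

Section Projection.
Context {V : IPS} {HV : is_hilbert V}.

Lemma closure_orthogonal (E : V -> Prop) (q y : V) :
  in_closure E q -> (forall e, E e -> vinner e y = C0) -> vinner q y = C0.
Proof.
  intros Hq HE. apply Cmod_eq0. apply NNPP; intros nz.
  pose proof (Cmod_ge0 (vinner q y)). pose proof (vnorm_ge0 y).
  destruct (Hq (Cmod (vinner q y) / (vnorm y + 1))) as (e & Ee & He);
    [apply Rdiv_lt_0_compat; lra |].
  assert (bound : Cmod (vinner q y) <= vnorm (vsub q e) * vnorm y).
  { replace (vinner q y) with (vinner (vsub q e) y); [apply Cmod_inner_le |].
    rewrite inner_subl, (HE e Ee). Cring. }
  apply (Rmult_lt_compat_r (vnorm y + 1)) in He; [| lra].
  unfold Rdiv in He. rewrite Rmult_assoc, Rinv_l in He by lra.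
  pose proof (vnorm_ge0 (vsub q e)). nra.
Qed.

Lemma vlim_in_closure (E : V -> Prop) (u : nat -> V) l :
  (forall n, E (u n)) -> vlim u l -> in_closure E l.
Proof.
  intros Eu cvg eps He. apply is_lim_seq_Reals in cvg. destruct (cvg eps He) as [N HN].
  exists (u N). split; [apply Eu |]. specialize (HN N (Nat.le_refl N)). unfold R_dist in HN.
  rewrite Rminus_0_r, Rabs_pos_eq in HN by apply vnorm_ge0. rewrite vnorm_sub_sym. exact HN.
Qed.

Lemma minimizing_sequence (E : V -> Prop) (x : V) : (exists e, E e) ->
  exists delta (e : nat -> V), (forall z, E z -> delta <= sqnorm (vsub x z)) /\
    forall n, E (e n) /\ sqnorm (vsub x (e n)) < delta + / (INR n + 1).
Proof.
  intros [e0 He0].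
  destruct (completeness (fun r => exists e, E e /\ r = - sqnorm (vsub x e))) as [s [ub lub]].
  - exists 0. intros r (e & _ & ->). pose proof (sqnorm_ge0 (vsub x e)). lra.
  - eauto.
  - destruct (choice (fun n e => E e /\ sqnorm (vsub x e) < - s + / (INR n + 1))) as [e He].
    { intros n. apply NNPP; intros C. pose proof (inv_succ_gt0 n).
      enough (s <= s - / (INR n + 1)) by lra.
      apply lub. intros r (e & He & ->). apply Rnot_lt_le; intros C'.
      apply C. exists e. split; [exact He | lra]. }
    exists (- s), e. split; [| exact He].
    intros z Hz. enough (- sqnorm (vsub x z) <= s) by lra. apply ub; eauto.
Qed.

(* The parallelogram law for [x - e n] and [x - e m], whose half sum is [x] minus the midpoint. *)
Lemma minimizing_sequence_cvg (E : V -> Prop) (x : V) delta (e : nat -> V) : is_subspace E ->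
  (forall z, E z -> delta <= sqnorm (vsub x z)) ->
  (forall n, E (e n) /\ sqnorm (vsub x (e n)) < delta + / (INR n + 1)) ->
  exists q, vlim e q.
Proof.
  intros (_ & Eadd & Escal) Hmin He. apply cauchy_vlim. intros eps Heps.
  destruct (archimed_cor1 (eps ^ 2 / 4)) as (N & HN & HN0); [nra |].
  exists N. intros n m Hn Hm. apply vnorm_lt; [lra |].
  destruct (He n) as [En Dn], (He m) as [Em Dm].
  assert (small : / (INR N + 1) < eps ^ 2 / 4).
  { eapply Rle_lt_trans; [| exact HN]. apply Rinv_le_contravar; [apply lt_0_INR; lia | lra]. }
  pose proof (inv_succ_le N n Hn). pose proof (inv_succ_le N m Hm).
  set (mid := vscal (CR (1 / 2)) (vadd (e n) (e m))).
  assert (mid_ge : delta <= sqnorm (vsub x mid)) by (apply Hmin, Escal, Eadd; assumption).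
  pose proof (parallelogram (vsub x (e m)) (vsub x (e n))) as law.
  replace (vadd (vsub x (e m)) (vsub x (e n))) with (vscal (CR 2) (vsub x mid)) in law
    by (unfold mid; apply inner_ext; intros z;
        rewrite inner_scall, inner_addl, !inner_subl, inner_scall, inner_addl;
        apply C_ext; simpl; field).
  replace (vsub (vsub x (e m)) (vsub x (e n))) with (vsub (e n) (e m)) in law by vring.
  rewrite sqnorm_CR in law. lra.
Qed.

Lemma quadratic_ge0_linear_eq0 b r : 0 <= b -> (forall t, 0 <= t ^ 2 * b - 2 * t * r) -> r = 0.
Proof.
  intros Hb H. specialize (H (r / (b + 1))).
  replace ((r / (b + 1)) ^ 2 * b - 2 * (r / (b + 1)) * r)
    with (- (r ^ 2 * (b + 2) / (b + 1) ^ 2)) in H by (field; lra).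
  assert (inv_gt0 : 0 < / (b + 1) ^ 2) by (apply Rinv_0_lt_compat; nra).
  unfold Rdiv in H.
  assert (r ^ 2 * (b + 2) <= 0) by nra. nra.
Qed.

Lemma orthogonal_of_minimal (E : V -> Prop) (r : V) : is_subspace E ->
  (forall z, E z -> sqnorm r <= sqnorm (vsub r z)) -> forall z, E z -> vinner z r = C0.
Proof.
  intros (_ & _ & Escal) Hmin.
  assert (re_eq0 : forall z, E z -> re_inner z r = 0).
  { intros z Ez. apply (quadratic_ge0_linear_eq0 (sqnorm z)); [apply sqnorm_ge0 |]. intros t.
    pose proof (Hmin (vscal (CR t) z) (Escal _ _ Ez)) as min_t.
    rewrite sqnorm_sub, sqnorm_CR, re_inner_CRr, (re_inner_sym z r) in min_t. lra. }
  intros z Ez. destruct (Cmod_phase (vinner z r)) as (w & _ & phase).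
  apply Cmod_eq0. rewrite <- phase, <- inner_scall. apply re_eq0, Escal, Ez.
Qed.

Theorem nearest_point (E : V -> Prop) (x : V) : is_subspace E ->
  exists q, in_closure E q /\ forall e, E e -> vinner e (vsub x q) = C0.
Proof.
  intros HE. pose proof HE as (E0 & Eadd & _).
  destruct (minimizing_sequence E x) as (delta & e & Hmin & He); [eauto |].
  destruct (minimizing_sequence_cvg E x delta e HE Hmin He) as [q Hq].
  exists q. split; [apply (vlim_in_closure E e); [apply He | exact Hq] |].
  apply orthogonal_of_minimal; [exact HE |]. intros z Ez. apply Rle_trans with delta.
  - refine (is_lim_seq_le _ _ _ delta (fun n => Rlt_le _ _ (proj2 (He n)))
              (vlim_sqnorm _ _ (vlim_subl _ _ x Hq)) _).
    replace (Finite delta) with (Finite (delta + 0)) by (f_equal; ring).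
    apply is_lim_seq_plus'; [apply is_lim_seq_const | apply is_lim_seq_inv_succ].
  - replace (vsub (vsub x q) z) with (vsub (vsub x z) q) by vring.
    refine (is_lim_seq_le (fun _ => delta) _ delta _ (fun n => _) (is_lim_seq_const _)
              (vlim_sqnorm _ _ (vlim_subl _ _ (vsub x z) Hq))).
    replace (vsub (vsub x z) (e n)) with (vsub x (vadd z (e n))) by vring.
    apply Hmin, Eadd; [exact Ez | apply He].
Qed.

Definition orth_component (W : V -> Prop) (x p : V) : Prop :=
  W (vsub x p) /\ forall w, W w -> vinner w p = C0.

(* [<P x, y> = <P x, P y>], which is symmetric in [x] and [y]: so [P] is self-adjoint, and a
   self-adjoint map is linear. *)
Lemma is_orth_proj_of_components (W : V -> Prop) (P : V -> V) :
  (forall x, orth_component W x (P x)) -> is_orth_proj P.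
Proof.
  intros HP.
  assert (sym : forall x y, vinner (P x) y = vinner (P x) (P y)).
  { intros x y. replace y with (vadd (vsub y (P y)) (P y)) at 1 by vring.
    rewrite inner_addr, (inner_orth_sym (vsub y (P y)) (P x)); [Cring |].
    apply (HP x), (HP y). }
  assert (adj : forall x y, vinner (P x) y = vinner x (P y)).
  { intros x y. rewrite sym, (inner_sym (P y) (P x)), <- (sym y x), <- inner_sym. reflexivity. }
  repeat split; [intros x y | intros a x | intros x | exact adj];
    apply inner_ext; intros z; rewrite ?inner_addl, ?inner_scall, !adj.
  - rewrite inner_addl. reflexivity.
  - rewrite inner_scall. reflexivity.
  - rewrite <- (adj x (P z)), <- sym. apply adj.
Qed.

Theorem orthogonal_complement_projection (W : V -> Prop) :
  is_subspace W -> (forall q, in_closure W q -> W q) ->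
  exists P : V -> V, is_orth_proj P /\ forall x, orth_component W x (P x).
Proof.
  intros HW closed. destruct (choice (orth_component W)) as [P HP].
  { intros x. destruct (nearest_point W x HW) as (q & Hq & orth). exists (vsub x q).
    split; [| exact orth]. replace (vsub x (vsub x q)) with q by vring. apply closed, Hq. }
  exists P. split; [exact (is_orth_proj_of_components W P HP) | exact HP].
Qed.

Corollary orth_family_projection (h : nat -> V) : exists P : V -> V, is_orth_proj P /\
  (forall x p, vinner (P x) (h p) = vinner x (h p)) /\
  (forall w x, (forall p, vinner w (h p) = C0) -> vinner w (P x) = C0).
Proof.
  destruct (orthogonal_complement_projection (fun w => forall p, vinner w (h p) = C0))
    as (P & HP & comp).
  - repeat split.
    + intros p. apply inner_zerol.
    + intros x y Hx Hy p. rewrite inner_addl, Hx, Hy. Cring.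
    + intros a x Hx p. rewrite inner_scall, Hx. Cring.
  - intros q Hq p. apply (closure_orthogonal _ _ _ Hq). intros e He. apply He.
  - exists P. split; [exact HP |]. split.
    + intros x p. destruct (comp x) as [W _]. specialize (W p). rewrite inner_subl in W.
      pose proof (f_equal Cre W). pose proof (f_equal Cim W). simpl in *. apply C_ext; lra.
    + intros w x Hw. apply comp, Hw.
Qed.

Lemma orth_proj_sqnorm_le (P : V -> V) (x : V) : is_orth_proj P -> sqnorm (P x) <= sqnorm x.
Proof.
  intros (_ & _ & idem & adj).
  assert (inner_Px : re_inner x (P x) = sqnorm (P x))
    by (unfold sqnorm, re_inner; rewrite (adj x (P x)), idem; reflexivity).
  pose proof (sqnorm_ge0 (vsub x (P x))) as dist_ge0. rewrite sqnorm_sub, inner_Px in dist_ge0. lra.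
Qed.

Lemma orth_proj_zero (P : V -> V) : is_orth_proj P -> P vzero = vzero.
Proof.
  intros HP. apply sqnorm_eq0, Rle_antisym; [| apply sqnorm_ge0].
  rewrite <- (sqnorm_zero (V := V)). apply orth_proj_sqnorm_le, HP.
Qed.
End Projection.

(** * Finite linear combinations *)

Lemma vsum_ext {V : IPS} n (g g' : nat -> V) :
  (forall j, (j < n)%nat -> g j = g' j) -> vsum n g = vsum n g'.
Proof. induction n; simpl; intros E; [reflexivity |]. rewrite IHn, E by auto. reflexivity. Qed.

Definition lin_span {V : IPS} (v : nat -> V) (x : V) : Prop :=
  exists n c, x = vsum n (fun j => vscal (c j) (v j)).

Lemma span_tail_full_closure {V : IPS} (a : nat -> V) N :
  span_tail_full a N <-> forall y, in_closure (lin_span (fun j => a (N + j)%nat)) y.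
Proof.
  split; intros H y eps He.
  - destruct (H y eps He) as (n & c & Hlt). eexists. split; [exists n, c; reflexivity | exact Hlt].
  - destruct (H y eps He) as (e & (n & c & ->) & Hlt). exists n, c. exact Hlt.
Qed.

Section LinearSpan.
Context {V : IPS} {HV : is_hilbert V}.

Lemma vsum_eq0 n (g : nat -> V) : (forall j, (j < n)%nat -> g j = vzero) -> vsum n g = vzero.
Proof. induction n; simpl; intros E; [reflexivity |]. rewrite IHn, E by auto. vring. Qed.

Lemma subspace_vsum (E : V -> Prop) n (g : nat -> V) :
  is_subspace E -> (forall j, E (g j)) -> E (vsum n g).
Proof. intros (E0 & Eadd & _) Hg. induction n; simpl; auto. Qed.

Lemma vsum_add n (g g' : nat -> V) :
  vadd (vsum n g) (vsum n g') = vsum n (fun j => vadd (g j) (g' j)).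
Proof. induction n; simpl; [| rewrite <- IHn]; vring. Qed.

Lemma vsum_scal n a (g : nat -> V) : vscal a (vsum n g) = vsum n (fun j => vscal a (g j)).
Proof. induction n; simpl; [| rewrite <- IHn]; vring. Qed.

Lemma vsum_pad n m (g : nat -> V) :
  vsum n g = vsum (n + m) (fun j => if (j <? n)%nat then g j else vzero).
Proof.
  induction m.
  - rewrite Nat.add_0_r. apply vsum_ext. intros j Hj.
    apply Nat.ltb_lt in Hj. rewrite Hj. reflexivity.
  - rewrite Nat.add_succ_r. simpl. rewrite <- IHm, (proj2 (Nat.ltb_ge _ _)) by lia. vring.
Qed.

Lemma lin_span_subspace (v : nat -> V) : is_subspace (lin_span v).
Proof.
  repeat split.
  - exists 0%nat, (fun _ => C0). reflexivity.
  - intros x y (n & c & ->) (m & c' & ->).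
    rewrite (vsum_pad n m), (vsum_pad m n), (Nat.add_comm m n), vsum_add.
    exists (n + m)%nat, (fun j => Cadd (if (j <? n)%nat then c j else C0)
                                      (if (j <? m)%nat then c' j else C0)).
    apply vsum_ext. intros j _. destruct (j <? n)%nat, (j <? m)%nat; vring.
  - intros a x (n & c & ->). rewrite vsum_scal. exists n, (fun j => Cmul a (c j)).
    apply vsum_ext. intros j _. vring.
Qed.

Lemma lin_span_mem (v : nat -> V) n : lin_span v (v n).
Proof.
  exists (S n), (fun j => if (j =? n)%nat then C1 else C0). simpl. rewrite vsum_eq0.
  - rewrite Nat.eqb_refl. vring.
  - intros j Hj. rewrite (proj2 (Nat.eqb_neq j n)) by lia. vring.
Qed.

Lemma dense_span_of_orth_eq0 (v : nat -> V) :
  (forall y, (forall n, vinner (v n) y = C0) -> y = vzero) -> forall x, in_closure (lin_span v) x.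
Proof.
  intros H x. destruct (nearest_point (lin_span v) x (lin_span_subspace v)) as (q & Hq & orth).
  rewrite (vsub_eq0 x q); [exact Hq |]. apply H. intros n. apply orth, lin_span_mem.
Qed.

Lemma orth_dense_span_eq0 (v : nat -> V) (y : V) :
  in_closure (lin_span v) y -> (forall n, vinner (v n) y = C0) -> y = vzero.
Proof.
  intros Hy orth. apply inner_self_eq0, (closure_orthogonal (lin_span v)); [exact Hy |].
  intros e (n & c & ->). induction n as [| n IH]; simpl; [apply inner_zerol |].
  rewrite inner_addl, IH, inner_scall, orth. Cring.
Qed.
End LinearSpan.

(** * Relatively compact sets *)

Section Compactness.
Context {V : IPS} {HV : is_hilbert V}.

(* Otherwise choose [x r] in [A] with [|<x r, h p>| < 1 / (r + 1)] for all [p <= r]: every limit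
   point of [x] is orthogonal to all [h p]. *)
Lemma rel_compact_norming (A : V -> Prop) (h : nat -> V) : rel_compact A ->
  (forall u l, (forall n, A (u n)) -> vlim u l -> exists p, vinner l (h p) <> C0) ->
  exists eps r, 0 < eps /\
    forall x, A x -> exists p, (p <= r)%nat /\ eps <= Cmod (vinner x (h p)).
Proof.
  intros comp nonorth. apply NNPP; intros C.
  destruct (choice (fun r x => A x /\
    forall p, (p <= r)%nat -> Cmod (vinner x (h p)) < / (INR r + 1))) as [x Hx].
  { intros r. apply NNPP; intros C'. apply C. exists (/ (INR r + 1)), r.
    split; [apply inv_succ_gt0 |]. intros y Hy. apply NNPP; intros Cy. apply C'. exists y.
    split; [exact Hy |]. intros p Hp. apply Rnot_le_lt; intros large. apply Cy. eauto. }
  destruct (comp x (fun n => proj1 (Hx n))) as (phi & l & incr & lim).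
  assert (phi_ge : forall n, (n <= phi n)%nat).
  { induction n; [lia |]. specialize (incr n). lia. }
  assert (cvg : vlim (fun n => x (phi n)) l) by (apply is_lim_seq_Reals; exact lim).
  destruct (nonorth _ _ (fun n => proj1 (Hx (phi n))) cvg) as [p Hp].
  apply Hp, Cmod_eq0, Rle_antisym; [| apply Cmod_ge0].
  refine (is_lim_seq_le_loc _ _ _ _ _ (vlim_Cmod_inner _ _ (h p) cvg) is_lim_seq_inv_succ).
  exists p. intros n Hn. eapply Rle_trans; [| exact (inv_succ_le _ _ (phi_ge n))].
  apply Rlt_le, Hx. specialize (phi_ge n). lia.
Qed.

Lemma completely_rel_compact_norming (a h : nat -> V) (P : V -> V) :
  completely_rel_compact a -> is_orth_proj P ->
  (forall w x, (forall p, vinner w (h p) = C0) -> vinner w (P x) = C0) ->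
  exists eps r, 0 < eps /\ forall k, exists p, (p <= r)%nat /\
    eps * vnorm (P (a k)) <= Cmod (vinner (P (a k)) (h p)).
Proof.
  intros comp HP Porth.
  destruct (rel_compact_norming _ h (comp P HP)) as (eps & r & Heps & norming).
  - intros u l Hu cvg. apply NNPP; intros C.
    assert (orth : forall p, vinner l (h p) = C0)
      by (intros p; apply NNPP; intros Cp; apply C; exists p; exact Cp).
    assert (norm0 : sqnorm l = 0).
    { refine (is_lim_seq_const_eq _ _ _ _ (proj1 (vlim_inner _ _ l cvg))).
      intros n. destruct (Hu n) as (k & _ & ->).
      rewrite inner_scall, (inner_orth_sym l (P (a k))) by apply Porth, orth. simpl. ring. }
    assert (norm1 : sqnorm l = 1).
    { refine (is_lim_seq_const_eq _ _ _ _ (vlim_sqnorm _ _ cvg)).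
      intros n. destruct (Hu n) as (k & nz & ->). rewrite sqnorm_CR, <- vnorm_sqr.
      field. apply Rgt_not_eq, vnorm_gt0, nz. }
    lra.
  - exists eps, r. split; [exact Heps |]. intros k.
    destruct (classic (P (a k) = vzero)) as [zero | nz].
    + exists 0%nat. split; [lia |]. rewrite zero, inner_zerol, Cmod_C0, vnorm_zero. lra.
    + destruct (norming _ (ex_intro _ k (conj nz eq_refl))) as (p & Hp & bound).
      exists p. split; [exact Hp |]. apply vnorm_gt0 in nz.
      rewrite inner_scall, Cmod_mul, Cmod_CR, Rabs_pos_eq in bound
        by (apply Rlt_le, Rinv_0_lt_compat, nz).
      apply (Rmult_le_compat_r (vnorm (P (a k)))) in bound; [| lra].
      eapply Rle_trans; [exact bound |]. right. field. lra.
Qed.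
End Compactness.

(** * Series *)

Lemma is_series_zero : is_series (fun _ => 0) 0.
Proof.
  change (is_lim_seq (sum_n (fun _ => 0)) 0).
  apply is_lim_seq_ext with (fun _ => 0); [| apply is_lim_seq_const].
  intros n. rewrite sum_n_const. ring.
Qed.

Lemma ex_series_Rle (a b : nat -> R) : (forall n, 0 <= a n <= b n) -> ex_series b -> ex_series a.
Proof.
  intros H. apply (ex_series_le a b). intros n. eapply Rle_trans; [| apply (H n)].
  right. apply Rabs_pos_eq, H.
Qed.

Lemma sum_n_ge0 (a : nat -> R) n : (forall k, 0 <= a k) -> 0 <= sum_n a n.
Proof. intros H. rewrite sum_n_Reals. apply cond_pos_sum, H. Qed.

Lemma sum_n_term_le (a : nat -> R) n k :
  (forall k, 0 <= a k) -> (k <= n)%nat -> a k <= sum_n a n.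
Proof.
  intros Ha Hk. induction Hk as [| n Hk IH].
  - destruct k; [rewrite sum_O; lra |]. rewrite sum_Sn. unfold plus; simpl.
    pose proof (sum_n_ge0 a k Ha). lra.
  - rewrite sum_Sn. unfold plus; simpl. pose proof (Ha (S n)). lra.
Qed.

Lemma ex_series_of_bounded_sums (a : nat -> R) M :
  (forall n, 0 <= a n) -> (forall n, sum_n a n <= M) -> ex_series a /\ Series a <= M.
Proof.
  intros H0 HM.
  assert (cvg : ex_finite_lim_seq (sum_n a)).
  { apply ex_finite_lim_seq_incr with M; [| exact HM].
    intros n. rewrite sum_Sn. unfold plus; simpl. pose proof (H0 (S n)). lra. }
  destruct cvg as [l Hl]. assert (sum : is_series a l) by exact Hl.
  split; [exists l; exact sum |]. rewrite (is_series_unique _ _ sum).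
  exact (is_lim_seq_le _ (fun _ => M) l M HM Hl (is_lim_seq_const M)).
Qed.

Lemma sum_n_le_Series (a : nat -> R) n :
  (forall n, 0 <= a n) -> ex_series a -> sum_n a n <= Series a.
Proof.
  intros H0 Ha. apply Series_correct in Ha.
  apply (is_lim_seq_incr_compare (sum_n a)); [exact Ha |].
  intros k. rewrite sum_Sn. unfold plus; simpl. pose proof (H0 (S k)). lra.
Qed.

Lemma term_le_Series (a : nat -> R) n : (forall n, 0 <= a n) -> ex_series a -> a n <= Series a.
Proof.
  intros H0 Ha. eapply Rle_trans; [apply (sum_n_term_le a n n H0 (Nat.le_refl n)) |].
  apply (sum_n_le_Series a n H0 Ha).
Qed.

Lemma Series_ge0 (a : nat -> R) : (forall n, 0 <= a n) -> ex_series a -> 0 <= Series a.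
Proof. intros H Ha. eapply Rle_trans; [apply (H 0%nat) | apply term_le_Series; auto]. Qed.

Lemma is_lim_seq_sum_n (a : nat -> nat -> R) (l : nat -> R) K :
  (forall k, is_lim_seq (fun n => a n k) (l k)) ->
  is_lim_seq (fun n => sum_n (a n) K) (sum_n l K).
Proof.
  intros H. induction K.
  - rewrite sum_O. apply is_lim_seq_ext with (fun n => a n 0%nat); [| apply H].
    intros n. rewrite sum_O. reflexivity.
  - rewrite sum_Sn. apply is_lim_seq_ext with (fun n => sum_n (a n) K + a n (S K)).
    { intros n. rewrite sum_Sn. reflexivity. }
    apply is_lim_seq_plus'; [exact IHK | apply H].
Qed.

Lemma is_series_sum_n (g : nat -> nat -> R) (l : nat -> R) n :
  (forall i, is_series (g i) (l i)) -> is_series (fun j => sum_n (fun i => g i j) n) (sum_n l n).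
Proof.
  intros Hg. induction n as [| n IH].
  - rewrite sum_O. apply is_series_ext with (g 0%nat); [| apply Hg].
    intros j. rewrite sum_O. reflexivity.
  - rewrite sum_Sn. apply is_series_ext with (fun j => plus (sum_n (fun i => g i j) n) (g (S n) j)).
    { intros j. rewrite sum_Sn. reflexivity. }
    exact (is_series_plus _ _ _ _ IH (Hg (S n))).
Qed.

Lemma Series_shift_le (a : nat -> R) n : (forall k, 0 <= a k) -> ex_series a ->
  Series (fun k => a (n + k)%nat) <= Series a.
Proof.
  intros H Ha. destruct n; [right; apply Series_ext; reflexivity |].
  rewrite (Series_incr_n a (S n)) by (auto; lia).
  pose proof (cond_pos_sum a (Nat.pred (S n)) H). lra.
Qed.

Lemma Series_tail_small (a : nat -> R) eps : ex_series a -> 0 < eps ->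
  exists N, forall n, (N <= n)%nat -> Series (fun k => a (n + k)%nat) < eps.
Proof.
  intros Ha He. pose proof (Series_correct a Ha) as cvg. apply is_series_Reals in cvg.
  destruct (cvg eps He) as [N HN]. exists (S N). intros n Hn. destruct n as [| n]; [lia |].
  specialize (HN n ltac:(lia)). rewrite (Series_incr_n a (S n)) in HN by (auto; lia).
  simpl Nat.pred in HN. unfold R_dist in HN. apply Rabs_def2 in HN. lra.
Qed.

(* Beyond a [K] where the tail of [w] has sum less than [1], the sum [tail] of the tail of
   [alpha] satisfies [tail <= sum w * tail]. *)
Lemma eventually_zero_of_le_tail (alpha w : nat -> R) K0 :
  (forall k, 0 <= alpha k) -> ex_series alpha -> (forall k, 0 <= w k) -> ex_series w ->
  (forall k, (K0 <= k)%nat -> alpha k <= w k * Series (fun j => alpha (k + S j)%nat)) ->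
  exists K, forall k, (K <= k)%nat -> alpha k = 0.
Proof.
  intros Ha alpha_sum Hw w_sum bound.
  destruct (Series_tail_small w 1 w_sum Rlt_0_1) as [K1 small].
  set (K := (K0 + K1)%nat). specialize (small K ltac:(unfold K; lia)).
  set (tail := Series (fun i => alpha (K + i)%nat)).
  assert (tail_ex : ex_series (fun i => alpha (K + i)%nat)) by apply ex_series_incr_n, alpha_sum.
  assert (tail_ge0 : 0 <= tail) by (apply Series_ge0; auto).
  assert (le_tail : forall i, alpha (K + i)%nat <= w (K + i)%nat * tail).
  { intros i. eapply Rle_trans; [apply bound; unfold K; lia |].
    apply Rmult_le_compat_l; [apply Hw |].
    rewrite (Series_ext _ (fun j => alpha (K + (S i + j))%nat)).
    - apply (Series_shift_le (fun i => alpha (K + i)%nat)); auto.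
    - intros j. f_equal. lia. }
  assert (contraction : tail <= Series (fun i => w (K + i)%nat) * tail).
  { rewrite <- Series_scal_r. apply Series_le; [intros i; split; auto |].
    apply ex_series_scal_r, ex_series_incr_n, w_sum. }
  exists K. intros k Hk. apply Rle_antisym; [| apply Ha].
  replace k with (K + (k - K))%nat by lia.
  eapply Rle_trans; [apply (term_le_Series _ (k - K) (fun i => Ha (K + i)%nat) tail_ex) |].
  fold tail. nra.
Qed.

Definition is_CSeries (z : nat -> C) (l : C) : Prop :=
  is_series (fun k => Cre (z k)) (Cre l) /\ is_series (fun k => Cim (z k)) (Cim l).

Definition CSeries (z : nat -> C) : C :=
  mkC (Series (fun k => Cre (z k))) (Series (fun k => Cim (z k))).

Lemma is_CSeries_unique z l : is_CSeries z l -> CSeries z = l.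
Proof. intros [Hre Him]. apply C_ext; apply is_series_unique; assumption. Qed.

Lemma CSeries_ext (z w : nat -> C) : (forall k, z k = w k) -> CSeries z = CSeries w.
Proof. intros E. apply C_ext; apply Series_ext; intros k; rewrite E; reflexivity. Qed.

Lemma is_CSeries_zero : is_CSeries (fun _ => C0) C0.
Proof. split; exact is_series_zero. Qed.

Lemma is_CSeries_add z w l l' : is_CSeries z l -> is_CSeries w l' ->
  is_CSeries (fun k => Cadd (z k) (w k)) (Cadd l l').
Proof.
  intros [Hre Him] [Hre' Him']. split; apply (is_series_plus (V := R_NormedModule)); assumption.
Qed.

Lemma is_CSeries_mul a z l : is_CSeries z l -> is_CSeries (fun k => Cmul a (z k)) (Cmul a l).
Proof.
  intros [Hre Him].
  assert (scal : forall c (b : nat -> R) s, is_series b s -> is_series (fun k => c * b k) (c * s))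
    by exact (is_series_scal (V := R_NormedModule)).
  split.
  - apply (is_series_minus (V := R_NormedModule)); apply scal; assumption.
  - apply (is_series_plus (V := R_NormedModule)); apply scal; assumption.
Qed.

Lemma is_CSeries_conj z l : is_CSeries z l -> is_CSeries (fun k => Cconj (z k)) (Cconj l).
Proof. intros [Hre Him]. split; [exact Hre | exact (is_series_opp _ _ Him)]. Qed.

Lemma is_CSeries_finsum d (z : nat -> Fin.t d -> C) (l : Fin.t d -> C) :
  (forall i, is_CSeries (fun k => z k i) (l i)) ->
  is_CSeries (fun k => finsum d (z k)) (finsum d l).
Proof.
  induction d; simpl; intros H; [exact is_CSeries_zero |].
  apply is_CSeries_add; [apply H | exact (IHd (fun k i => z k (Fin.FS i)) _ (fun i => H _))].
Qed.

Lemma CSeries_drop_zeros (z : nat -> C) r :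
  (forall k, (k < r)%nat -> z k = C0) -> CSeries z = CSeries (fun k => z (r + k)%nat).
Proof.
  intros H. apply C_ext.
  - apply (Series_incr_n_aux (fun k => Cre (z k)) r).
    intros k Hk. rewrite H by exact Hk. reflexivity.
  - apply (Series_incr_n_aux (fun k => Cim (z k)) r).
    intros k Hk. rewrite H by exact Hk. reflexivity.
Qed.

Lemma CSeries_first_term (z : nat -> C) (l : C) r : is_CSeries z l ->
  (forall k, (k < r)%nat -> z k = C0) -> l = Cadd (z r) (CSeries (fun k => z (r + S k)%nat)).
Proof.
  intros Hz zero. rewrite <- (is_CSeries_unique z l Hz), (CSeries_drop_zeros z r zero).
  destruct Hz as [Hre Him].
  apply C_ext; simpl; rewrite Series_incr_1, Nat.add_0_r; try reflexivity;
    [exact (proj1 (ex_series_incr_n (fun k => Cre (z k)) r) (ex_intro _ _ Hre))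
    |exact (proj1 (ex_series_incr_n (fun k => Cim (z k)) r) (ex_intro _ _ Him))].
Qed.

(** * Finite powers *)

Lemma finsum_add d (g h : Fin.t d -> C) :
  finsum d (fun i => Cadd (g i) (h i)) = Cadd (finsum d g) (finsum d h).
Proof. induction d; simpl; [| rewrite IHd]; Cring. Qed.

Lemma finsum_mul d a (g : Fin.t d -> C) :
  finsum d (fun i => Cmul a (g i)) = Cmul a (finsum d g).
Proof. induction d; simpl; [| rewrite IHd]; Cring. Qed.

Lemma finsum_conj d (g : Fin.t d -> C) : finsum d (fun i => Cconj (g i)) = Cconj (finsum d g).
Proof. induction d; simpl; [| rewrite IHd]; Cring. Qed.

Lemma finsum_zero d : finsum d (fun _ => C0) = C0.
Proof. induction d; simpl; [| rewrite IHd]; Cring. Qed.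

Lemma finsum_re_le d (g h : Fin.t d -> C) :
  (forall i, Cre (g i) <= Cre (h i)) -> Cre (finsum d g) <= Cre (finsum d h).
Proof.
  induction d; simpl; intros H; [lra |].
  pose proof (H Fin.F1).
  pose proof (IHd (fun i => g (Fin.FS i)) (fun i => h (Fin.FS i)) (fun i => H (Fin.FS i))). lra.
Qed.

Lemma finsum_re_ge0 d (g : Fin.t d -> C) : (forall i, 0 <= Cre (g i)) -> 0 <= Cre (finsum d g).
Proof.
  intros H. eapply Rle_trans; [| apply (finsum_re_le d (fun _ => C0) g H)].
  rewrite finsum_zero. simpl. lra.
Qed.

Lemma finsum_re_term_le d (g : Fin.t d -> C) i :
  (forall i, 0 <= Cre (g i)) -> Cre (g i) <= Cre (finsum d g).
Proof.
  induction i; simpl; intros H.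
  - pose proof (finsum_re_ge0 _ (fun i => g (Fin.FS i)) (fun i => H (Fin.FS i))). lra.
  - pose proof (H Fin.F1). pose proof (IHi (fun i => g (Fin.FS i)) (fun i => H (Fin.FS i))). lra.
Qed.

Lemma is_lim_seq_finsum_re d (g : nat -> Fin.t d -> C) (l : Fin.t d -> C) :
  (forall i, is_lim_seq (fun n => Cre (g n i)) (Cre (l i))) ->
  is_lim_seq (fun n => Cre (finsum d (g n))) (Cre (finsum d l)).
Proof.
  induction d; simpl; intros H; [apply is_lim_seq_const |].
  apply is_lim_seq_plus'; [apply H | exact (IHd (fun n i => g n (Fin.FS i)) _ (fun i => H _))].
Qed.

Lemma vsum_coord {X : IPS} d n (g : nat -> powIPS X d) i : vsum n g i = vsum n (fun k => g k i).
Proof. induction n; simpl; [reflexivity |]. rewrite IHn. reflexivity. Qed.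

Section FinitePower.
Context {X : IPS} {HX : is_hilbert X} {d : nat}.

Lemma sqnorm_coord_le (u : powIPS X d) i : sqnorm (u i) <= sqnorm u.
Proof. apply (finsum_re_term_le d (fun i => vinner (u i) (u i))). intros j. apply sqnorm_ge0. Qed.

Lemma vlim_coord (u : nat -> powIPS X d) (l : powIPS X d) :
  (forall i, vlim (fun n => u n i) (l i)) -> vlim u l.
Proof.
  intros H. apply vlim_of_sqnorm.
  replace (Finite 0) with (Finite (Cre (finsum d (fun _ => C0))))
    by (rewrite finsum_zero; reflexivity).
  apply is_lim_seq_finsum_re. intros i. exact (vlim_sqnorm_sub _ _ (H i)).
Qed.

Lemma pow_complete (u : nat -> powIPS X d) : vcauchy u -> exists l, vlim u l.
Proof.
  intros Hu.
  destruct (cauchy_vlim_coordinates u (fun i (v : powIPS X d) => v i) Hu) as [l Hl].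
  - intros i n m.
    exact (sqrt_le_1_alt _ _ (sqnorm_coord_le (@vsub (powIPS X d) (u n) (u m)) i)).
  - exists l. exact (vlim_coord u l Hl).
Qed.

#[export] Instance pow_hilbert : is_hilbert (powIPS X d).
Proof.
  pose proof HX as (addA & addC & add0 & addN & scal1 & scalA & scalDr & scalDl &
    innD & innZ & innC & inn0 & _).
  repeat apply conj; simpl.
  1-8: intros; apply functional_extensionality; intros i; auto.
  - intros x y z. rewrite <- finsum_add. f_equal. apply functional_extensionality; auto.
  - intros a x y. rewrite <- finsum_mul. f_equal. apply functional_extensionality; auto.
  - intros x y. rewrite <- finsum_conj. f_equal. apply functional_extensionality; auto.
  - intros x. apply finsum_re_ge0; auto.
  - intros x Hx. apply functional_extensionality; intros i. apply sqnorm_eq0, Rle_antisym;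
      [| apply sqnorm_ge0].
    eapply Rle_trans; [apply (sqnorm_coord_le x i) | right; exact (f_equal Cre Hx)].
  - intros u Hu. destruct (pow_complete u Hu) as [l Hl]. exists l. apply is_lim_seq_Reals, Hl.
Qed.
End FinitePower.

(** * Square summable sequences *)

Definition H2_inner {V : IPS} (F G : nat -> V) : C := CSeries (fun k => vinner (F k) (G k)).
Definition H2_sqnorm {V : IPS} (F : nat -> V) : R := Series (fun k => sqnorm (F k)).

Section SquareSummable.
Context {V : IPS} {HV : is_hilbert V}.

Lemma in_H2_ex_series (F : nat -> V) : in_H2 F <-> ex_series (fun k => sqnorm (F k)).
Proof.
  split; intros [s Hs]; exists s.
  - apply is_series_Reals in Hs. eapply is_series_ext; [| exact Hs]. intros n. apply vnorm_sqr.
  - apply is_series_Reals. eapply is_series_ext; [| exact Hs]. intros n. symmetry. apply vnorm_sqr.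
Qed.

Lemma H2_dist_lt_iff (F G : nat -> V) eps : H2_dist_lt F G eps <->
  in_H2 (fun k => vsub (F k) (G k)) /\ H2_sqnorm (fun k => vsub (F k) (G k)) < eps ^ 2.
Proof.
  assert (sum_eq : forall s, infinite_sum (fun k => vnorm (vsub (F k) (G k)) ^ 2) s ->
                H2_sqnorm (fun k => vsub (F k) (G k)) = s).
  { intros s Hs. apply is_series_unique. apply is_series_Reals in Hs.
    eapply is_series_ext; [| exact Hs]. intros k. apply vnorm_sqr. }
  split.
  - intros (s & Hs & Hlt). rewrite (sum_eq s Hs). split; [exists s; exact Hs | exact Hlt].
  - intros ([s Hs] & Hlt). rewrite (sum_eq s Hs) in Hlt. exists s. split; assumption.
Qed.

Lemma in_H2_le (F : nat -> V) (b : nat -> R) :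
  (forall k, sqnorm (F k) <= b k) -> ex_series b -> in_H2 F.
Proof.
  intros H Hb. apply in_H2_ex_series, ex_series_Rle with b; [| exact Hb].
  intros n. split; [apply sqnorm_ge0 | apply H].
Qed.

Lemma in_H2_zero : in_H2 (fun _ => vzero : V).
Proof.
  apply in_H2_le with (fun _ => 0); [| exists 0; exact is_series_zero].
  intros k. rewrite sqnorm_zero. lra.
Qed.

Lemma in_H2_add (F G : nat -> V) : in_H2 F -> in_H2 G -> in_H2 (fun k => vadd (F k) (G k)).
Proof.
  rewrite (in_H2_ex_series F), (in_H2_ex_series G). intros HF HG.
  apply in_H2_le with (fun k => 2 * (sqnorm (F k) + sqnorm (G k))).
  - intros k. pose proof (parallelogram (F k) (G k)).
    pose proof (sqnorm_ge0 (vsub (F k) (G k))). lra.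
  - exact (ex_series_scal_l (V := R_NormedModule) 2 _ (ex_series_plus _ _ HF HG)).
Qed.

Lemma in_H2_scal a (F : nat -> V) : in_H2 F -> in_H2 (fun k => vscal a (F k)).
Proof.
  rewrite (in_H2_ex_series F). intros HF. apply in_H2_le with (fun k => Cmod a ^ 2 * sqnorm (F k)).
  - intros k. right. apply sqnorm_scal.
  - exact (ex_series_scal_l (V := R_NormedModule) _ _ HF).
Qed.

Lemma in_H2_sub (F G : nat -> V) : in_H2 F -> in_H2 G -> in_H2 (fun k => vsub (F k) (G k)).
Proof. intros HF HG. apply in_H2_add; [exact HF | apply in_H2_scal, HG]. Qed.


Lemma H2_sqnorm_ge0 (F : nat -> V) : in_H2 F -> 0 <= H2_sqnorm F.
Proof. intros HF. apply Series_ge0; [intros k; apply sqnorm_ge0 | apply in_H2_ex_series, HF]. Qed.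

Lemma sqnorm_le_H2_sqnorm (F : nat -> V) k : in_H2 F -> sqnorm (F k) <= H2_sqnorm F.
Proof.
  intros HF. apply (term_le_Series (fun k => sqnorm (F k)));
    [intros n; apply sqnorm_ge0 | apply in_H2_ex_series, HF].
Qed.

Lemma sum_n_le_H2_sqnorm (F : nat -> V) K :
  in_H2 F -> sum_n (fun k => sqnorm (F k)) K <= H2_sqnorm F.
Proof.
  intros HF. apply sum_n_le_Series; [intros n; apply sqnorm_ge0 | apply in_H2_ex_series, HF].
Qed.

Lemma is_CSeries_inner (F G : nat -> V) : in_H2 F -> in_H2 G ->
  is_CSeries (fun k => vinner (F k) (G k)) (H2_inner F G).
Proof.
  rewrite (in_H2_ex_series F), (in_H2_ex_series G). intros HF HG.
  assert (bound : forall k, Cmod (vinner (F k) (G k)) <= sqnorm (F k) + sqnorm (G k)).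
  { intros k. eapply Rle_trans; [apply Cmod_inner_le |]. rewrite <- !vnorm_sqr.
    pose proof (vnorm_ge0 (F k)). pose proof (vnorm_ge0 (G k)). nra. }
  pose proof (ex_series_plus _ _ HF HG) as HFG.
  split; apply Series_correct, (ex_series_le (V := R_CompleteNormedModule) _ _) with (2 := HFG);
    intros k; (eapply Rle_trans; [| apply bound]); [apply Cre_abs_le | apply Cim_abs_le].
Qed.

Lemma in_H2_bshift n (F : nat -> V) : in_H2 F -> in_H2 (bshift_iter n F).
Proof.
  rewrite !in_H2_ex_series. intros H. apply (ex_series_incr_n _ n) in H.
  eapply ex_series_ext; [| exact H].
  intros k. unfold bshift_iter. rewrite Nat.add_comm. reflexivity.
Qed.

Lemma in_H2_tail n (F : nat -> V) : in_H2 F -> in_H2 (fun j => F (n + S j)%nat).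
Proof.
  rewrite !in_H2_ex_series. intros H. apply (ex_series_incr_n _ (S n)) in H.
  eapply ex_series_ext; [| exact H]. intros j. rewrite Nat.add_succ_r. reflexivity.
Qed.

Lemma in_H2_lim (u : nat -> nat -> V) (l : nat -> V) M :
  (forall k, vlim (fun n => u n k) (l k)) ->
  (exists N, forall n, (n >= N)%nat -> in_H2 (u n) /\ H2_sqnorm (u n) <= M) ->
  in_H2 l /\ H2_sqnorm l <= M.
Proof.
  intros Hl [N HN].
  destruct (ex_series_of_bounded_sums (fun k => sqnorm (l k)) M) as [Hex Hle].
  - intros k. apply sqnorm_ge0.
  - intros K. refine (is_lim_seq_le_loc (fun n => sum_n (fun k => sqnorm (u n k)) K) (fun _ => M)
      _ M _ (is_lim_seq_sum_n _ _ _ (fun k => vlim_sqnorm _ _ (Hl k))) (is_lim_seq_const _)).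
    exists N. intros n Hn. destruct (HN n Hn) as [Hu Hle].
    exact (Rle_trans _ _ _ (sum_n_le_H2_sqnorm (u n) K Hu) Hle).
  - split; [apply in_H2_ex_series, Hex | exact Hle].
Qed.

Definition l2_space : IPS :=
  mkIPS {F : nat -> V | in_H2 F}
    (exist _ _ in_H2_zero)
    (fun F G => exist _ _ (in_H2_add _ _ (proj2_sig F) (proj2_sig G)))
    (fun a F => exist _ _ (in_H2_scal a _ (proj2_sig F)))
    (fun F G => H2_inner (proj1_sig F) (proj1_sig G)).

Definition coef (F : l2_space) : nat -> V := proj1_sig F.

Lemma l2_ext (F G : l2_space) : (forall k, coef F k = coef G k) -> F = G.
Proof.
  destruct F as [F HF], G as [G HG]; unfold coef; simpl; intros E.
  apply functional_extensionality in E. subst G. f_equal. apply proof_irrelevance.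
Qed.

Lemma coef_in_H2 (F : l2_space) : in_H2 (coef F).
Proof. exact (proj2_sig F). Qed.

Lemma coef_vsum n (g : nat -> l2_space) k : coef (vsum n g) k = vsum n (fun j => coef (g j) k).
Proof. induction n; [reflexivity |]. simpl. rewrite <- IHn. reflexivity. Qed.

Lemma l2_vnorm_sqr (F : l2_space) : vnorm F ^ 2 = H2_sqnorm (coef F).
Proof. apply pow2_sqrt. exact (H2_sqnorm_ge0 _ (coef_in_H2 F)). Qed.

Lemma coef_vnorm_le (F : l2_space) k : vnorm (coef F k) <= vnorm F.
Proof. exact (sqrt_le_1_alt _ _ (sqnorm_le_H2_sqnorm (coef F) k (coef_in_H2 F))). Qed.

Lemma l2_complete (u : nat -> l2_space) : vcauchy u -> exists l, vlim u l.
Proof.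
  intros Hu.
  destruct (cauchy_vlim_coordinates u (fun k F => coef F k) Hu) as [l Hl].
  { intros k n m. exact (coef_vnorm_le (vsub (u n) (u m)) k). }
  assert (close : forall eps, eps > 0 -> exists N, forall n, (n >= N)%nat ->
            in_H2 (fun k => vsub (coef (u n) k) (l k)) /\
            H2_sqnorm (fun k => vsub (coef (u n) k) (l k)) <= eps ^ 2).
  { intros eps He. destruct (Hu eps He) as [N HN]. exists N. intros n Hn.
    apply (in_H2_lim (fun m => coef (vsub (u n) (u m)))).
    - intros k. exact (vlim_subl _ _ _ (Hl k)).
    - exists N. intros m Hm. split; [apply coef_in_H2 |]. rewrite <- l2_vnorm_sqr.
      apply pow_incr. split; [apply sqrt_pos | apply Rlt_le, HN; assumption]. }
  assert (lH2 : in_H2 l).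
  { destruct (close 1) as [N HN]; [lra |]. destruct (HN N (Nat.le_refl N)) as [H _].
    replace l with (fun k => vsub (coef (u N) k) (vsub (coef (u N) k) (l k))).
    - apply in_H2_sub; [apply coef_in_H2 | exact H].
    - apply functional_extensionality; intros k. vring. }
  exists (exist _ l lH2). apply is_lim_seq_Reals. intros eps He.
  destruct (close (eps / 2)) as [N HN]; [lra |]. exists N. intros n Hn.
  unfold R_dist. rewrite Rminus_0_r, Rabs_pos_eq by apply sqrt_pos.
  apply Rle_lt_trans with (eps / 2); [| lra].
  rewrite <- (sqrt_pow2 (eps / 2)) by lra.
  apply sqrt_le_1_alt. exact (proj2 (HN n Hn)).
Qed.

#[export] Instance l2_hilbert : is_hilbert l2_space.
Proof.
  pose proof HV as (addA & addC & add0 & addN & scal1 & scalA & scalDr & scalDl & _).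
  pose proof (fun F G : l2_space =>
    is_CSeries_inner _ _ (coef_in_H2 F) (coef_in_H2 G)) as inner.
  repeat apply conj.
  1-8: intros; apply l2_ext; intros k; unfold coef; simpl; auto.
  - intros x y z. etransitivity; [apply CSeries_ext; intros k; apply inner_addl |].
    apply is_CSeries_unique, is_CSeries_add; apply inner.
  - intros a x y. etransitivity; [apply CSeries_ext; intros k; apply inner_scall |].
    apply is_CSeries_unique, is_CSeries_mul, inner.
  - intros x y. etransitivity; [apply CSeries_ext; intros k; apply inner_sym |].
    apply is_CSeries_unique, is_CSeries_conj, inner.
  - intros x. exact (H2_sqnorm_ge0 _ (coef_in_H2 x)).
  - intros x Hx. apply l2_ext. intros k. apply sqnorm_eq0, Rle_antisym; [| apply sqnorm_ge0].
    eapply Rle_trans; [apply (sqnorm_le_H2_sqnorm (coef x) k (coef_in_H2 x)) |].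
    right. exact (f_equal Cre Hx).
  - intros u Hu. destruct (l2_complete u Hu) as [l Hl]. exists l. apply is_lim_seq_Reals, Hl.
Qed.

Lemma H2_cauchy_schwarz (F G : nat -> V) : in_H2 F -> in_H2 G ->
  Cmod (H2_inner F G) ^ 2 <= H2_sqnorm F * H2_sqnorm G.
Proof.
  intros HF HG. exact (Cmod_inner_sqr_le (exist _ F HF : l2_space) (exist _ G HG : l2_space)).
Qed.

Theorem cyclic_bshift_of_orth_eq0 (f : nat -> V) : in_H2 f ->
  (forall h, in_H2 h -> (forall n, H2_inner (bshift_iter n f) h = C0) -> forall k, h k = vzero) ->
  cyclic_bshift f.
Proof.
  intros Hf H G HG eps He.
  set (shifts := fun n => exist _ _ (in_H2_bshift n f Hf) : l2_space).
  destruct (dense_span_of_orth_eq0 shifts) with (x := exist _ G HG : l2_space) (eps := eps)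
    as (e & (N & c & ->) & Hlt); [| exact He |].
  - intros h orth. apply l2_ext. exact (H (coef h) (coef_in_H2 h) orth).
  - exists N, c. apply H2_dist_lt_iff.
    set (diff := vsub _ _) in Hlt.
    assert (coef_diff : coef diff =
      fun k => vsub (G k) (vsum N (fun n => vscal (c n) (bshift_iter n f k)))).
    { apply functional_extensionality; intros k. unfold diff.
      change (vsub (G k) (coef (vsum N (fun j => vscal (c j) (shifts j))) k) =
        vsub (G k) (vsum N (fun n => vscal (c n) (bshift_iter n f k)))).
      rewrite coef_vsum. reflexivity. }
    rewrite <- coef_diff. split; [apply coef_in_H2 | exact (sqnorm_lt diff eps Hlt)].
Qed.
End SquareSummable.

(** * Lacunary sets *)

Definition indicator (P : Prop) : R := if excluded_middle_informative P then 1 else 0.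

Lemma indicator_true P : P -> indicator P = 1.
Proof. unfold indicator. destruct excluded_middle_informative; tauto. Qed.

Lemma indicator_false P : ~ P -> indicator P = 0.
Proof. unfold indicator. destruct excluded_middle_informative; tauto. Qed.

Lemma indicator_bounds P : 0 <= indicator P <= 1.
Proof. unfold indicator. destruct excluded_middle_informative; lra. Qed.

Lemma indicator_sqr P : indicator P ^ 2 = indicator P.
Proof. unfold indicator. destruct excluded_middle_informative; ring. Qed.

Lemma indicator_andl (P Q : Prop) : P -> indicator (P /\ Q) = indicator Q.
Proof.
  unfold indicator. intros p.
  destruct excluded_middle_informative, excluded_middle_informative; tauto.
Qed.

Definition gap_ratio (c : R) (A : nat -> Prop) : Prop :=
  forall x y, A x -> A y -> (x < y)%nat -> c * INR x <= INR y.

Lemma lacunary_gap_ratio Lam : lacunary_infinite Lam -> exists c, 1 < c /\ gap_ratio c Lam.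
Proof.
  intros (n & c & incr & mem & Hc & ratio). exists c. split; [lra |].
  assert (mono : forall i j, (i <= j)%nat -> (n i <= n j)%nat).
  { intros i j Hij. induction Hij; [lia |]. specialize (incr m). lia. }
  intros x y Hx Hy Hxy. apply mem in Hx, Hy. destruct Hx as [i ->], Hy as [j ->].
  assert (Hij : (S i <= j)%nat).
  { apply Nat.nlt_ge; intros C. assert (n j <= n i)%nat by (apply mono; lia). lia. }
  apply Rle_trans with (INR (n (S i))); [apply Rge_le, ratio | apply le_INR, mono, Hij].
Qed.

Lemma gap_ratio_count_le (c : R) (A : nat -> Prop) (q B n : nat) :
  1 < c -> gap_ratio c A -> (1 <= q)%nat -> (forall y, A y -> INR y < INR q * c ^ B) ->
  sum_n (fun i => indicator (A (q + i)%nat)) n <= INR B.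
Proof.
  intros Hc HA Hq upper. apply le_INR in Hq. simpl in Hq.
  assert (count_next : forall N y, (N <= B)%nat ->
    (forall z, A z -> (y <= z)%nat -> INR q * c ^ N <= INR z) ->
    exists N', (N' <= B)%nat /\ INR N + indicator (A y) = INR N' /\
      forall z, A z -> (y < z)%nat -> INR q * c ^ N' <= INR z).
  { intros N y HN low. destruct (classic (A y)) as [Ay | Ay].
    - exists (N + 1)%nat. pose proof (low y Ay (Nat.le_refl y)) as lowy. repeat split.
      + apply Nat.nlt_ge; intros C. specialize (upper y Ay).
        replace B with N in upper by lia. lra.
      + rewrite indicator_true, plus_INR by exact Ay. reflexivity.
      + intros z Az Hz. pose proof (HA y z Ay Az Hz).
        rewrite pow_add, pow_1. nra.
    - exists N. rewrite indicator_false by exact Ay. repeat split; [exact HN | ring |].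
      intros z Az Hz. apply low; [exact Az | lia]. }
  assert (count : exists N, (N <= B)%nat /\ sum_n (fun i => indicator (A (q + i)%nat)) n = INR N /\
    forall z, A z -> (q + n < z)%nat -> INR q * c ^ N <= INR z).
  { induction n as [| n (N & HN & EN & low)].
    - destruct (count_next 0%nat q) as (N & HN & EN & low); [lia | |].
      + intros z _ Hz. apply le_INR in Hz. simpl. lra.
      + exists N. rewrite sum_O, Nat.add_0_r, <- EN. simpl.
        repeat split; [exact HN | ring | exact low].
    - destruct (count_next N (q + S n)%nat HN) as (N' & HN' & EN' & low').
      + intros z Az Hz. apply low; [exact Az | lia].
      + exists N'. rewrite sum_Sn, EN, <- EN'. repeat split; [exact HN' | exact low']. }
  destruct count as (N & HN & -> & _). apply le_INR, HN.
Qed.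

Section GapRatio.
Context {c : R} {Lam : nat -> Prop} (Hc : 1 < c) (HLam : gap_ratio c Lam).

Lemma gap_ratio_sparse r :
  exists K, forall j k, (K <= j)%nat -> (j < k)%nat -> Lam j -> Lam k -> (j + r < k)%nat.
Proof.
  destruct (archimed_cor1 ((c - 1) / (INR r + 1))) as (K & HK & HK0).
  { apply Rdiv_lt_0_compat; [lra |]. pose proof (pos_INR r). lra. }
  exists K. intros j k Hj Hjk Lj Lk. apply INR_lt. rewrite plus_INR.
  pose proof (HLam j k Lj Lk Hjk) as ratio.
  apply le_INR in Hj. apply lt_0_INR in HK0. pose proof (pos_INR r).
  assert (large : INR r + 1 < INR K * (c - 1)).
  { apply (Rmult_lt_compat_r (INR K * (INR r + 1))) in HK; [| nra].
    field_simplify in HK; try lra. }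
  nra.
Qed.

(* If [k] and [k + q] belong to [Lam], then [c k <= k + q] confines [k + q] to
   [[q, q c / (c - 1)]]. *)
Lemma gap_ratio_pair_count_bounded : exists B, 0 <= B /\ forall q n, (1 <= q)%nat ->
  sum_n (fun k => indicator (Lam k /\ Lam (k + q)%nat)) n <= B.
Proof.
  destruct (Pow_x_infinity c ltac:(rewrite Rabs_pos_eq; lra) (c / (c - 1) + 1)) as [B HB].
  specialize (HB B (Nat.le_refl B)). rewrite Rabs_pos_eq in HB by (apply pow_le; lra).
  exists (INR B). split; [apply pos_INR |]. intros q n Hq.
  rewrite (sum_n_ext _ (fun k => indicator (Lam (q + k - q)%nat /\ Lam (q + k)%nat))).
  2:{ intros k. rewrite (Nat.add_comm q k), Nat.add_sub. reflexivity. }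
  apply (gap_ratio_count_le c (fun y => Lam (y - q)%nat /\ Lam y)); [exact Hc | | exact Hq |].
  - intros x y [_ Lx] [_ Ly]. apply HLam; assumption.
  - intros y [Lyq Ly].
    assert (q_ge1 : 1 <= INR q) by (apply (le_INR 1), Hq).
    destruct (Nat.lt_ge_cases y q) as [Hy | Hy].
    + apply lt_INR in Hy. pose proof (pow_R1_Rle c B ltac:(lra)). nra.
    + pose proof (HLam (y - q)%nat y Lyq Ly ltac:(lia)) as ratio.
      rewrite minus_INR in ratio by exact Hy.
      assert (expand : (c - 1) * (c / (c - 1) + 1) = c + (c - 1)) by (field; lra).
      assert (pow_ge : c + (c - 1) <= (c - 1) * c ^ B) by nra.
      assert ((c - 1) * INR y < (c - 1) * (INR q * c ^ B)) by nra. nra.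
Qed.
End GapRatio.

Definition gap_sum (Lam : nat -> Prop) (H : nat -> R) (k : nat) : R :=
  Series (fun j => indicator (Lam k /\ Lam (k + S j)%nat) * H j).

Section GapSum.
Context (Lam : nat -> Prop) (H : nat -> R) (H_ge0 : forall j, 0 <= H j) (H_sum : ex_series H).

Lemma indicator_mul_bounds P j : 0 <= indicator P * H j <= H j.
Proof. pose proof (indicator_bounds P). pose proof (H_ge0 j). nra. Qed.

Lemma gap_sum_ge0 k : 0 <= gap_sum Lam H k.
Proof.
  apply Series_ge0; [intros j; apply indicator_mul_bounds |].
  apply ex_series_Rle with H; [intros j; apply indicator_mul_bounds | exact H_sum].
Qed.

(* Summing over [k] first, each [H j] is counted once per pair of members of [Lam] at distance
   [S j]. *)
Lemma ex_series_gap_sum c : 1 < c -> gap_ratio c Lam -> ex_series (gap_sum Lam H).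
Proof.
  intros Hc HLam. destruct (gap_ratio_pair_count_bounded Hc HLam) as (B & HB & count).
  apply (ex_series_of_bounded_sums _ (B * Series H)); [exact gap_sum_ge0 |]. intros n.
  assert (ex : forall k, ex_series (fun j => indicator (Lam k /\ Lam (k + S j)%nat) * H j)).
  { intros k. apply ex_series_Rle with H; [intros j; apply indicator_mul_bounds | exact H_sum]. }
  pose proof (is_series_sum_n _ _ n (fun k => Series_correct _ (ex k))) as swap.
  apply is_series_unique in swap. unfold gap_sum. rewrite <- swap, <- Series_scal_l.
  apply Series_le; [| exact (ex_series_scal_l (V := R_NormedModule) B _ H_sum)].
  intros j. rewrite (sum_n_mult_r (K := R_Ring) (H j)). unfold mult; simpl mult. split.
  - apply Rmult_le_pos; [apply sum_n_ge0; intros; apply indicator_bounds | apply H_ge0].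
  - apply Rmult_le_compat_r; [apply H_ge0 | apply (count (S j)); lia].
Qed.
End GapSum.

(** * Vectors orthogonal to the shifts of a lacunary sequence *)

Section LacunaryOrthogonality.
Context {V : IPS} {HV : is_hilbert V}.

Lemma in_H2_indicator (P : nat -> Prop) (F : nat -> V) :
  in_H2 F -> in_H2 (fun j => vscal (CR (indicator (P j))) (F j)).
Proof.
  rewrite (in_H2_ex_series F). apply in_H2_le. intros j. rewrite sqnorm_CR, indicator_sqr.
  apply (indicator_mul_bounds (fun j => sqnorm (F j))). intros i. apply sqnorm_ge0.
Qed.

Lemma H2_sqnorm_indicator (P : nat -> Prop) (F : nat -> V) :
  H2_sqnorm (fun j => vscal (CR (indicator (P j))) (F j)) =
  Series (fun j => indicator (P j) * sqnorm (F j)).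
Proof. apply Series_ext. intros j. rewrite sqnorm_CR, indicator_sqr. reflexivity. Qed.

Definition window_sqnorm (h : nat -> V) (r j : nat) : R :=
  sum_n (fun p => sqnorm (h (p + S j)%nat)) r.

Lemma window_sqnorm_ge0 (h : nat -> V) r j : 0 <= window_sqnorm h r j.
Proof. apply sum_n_ge0. intros p. apply sqnorm_ge0. Qed.

Lemma ex_series_window_sqnorm (h : nat -> V) r : in_H2 h -> ex_series (window_sqnorm h r).
Proof.
  intros Hh. eexists. apply is_series_sum_n. intros p. apply Series_correct.
  apply (in_H2_ex_series (fun j => h (p + S j)%nat)), in_H2_tail, Hh.
Qed.

Section Correlation.
Context (Lam : nat -> Prop) (b h : nat -> V) (Hb : in_H2 b) (Hh : in_H2 h)
  (supp : forall k, ~ Lam k -> b k = vzero)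
  (orth : forall n, H2_inner (bshift_iter n b) h = C0).

(* Since [b (s + (k - p))] vanishes for [s < p], the term [s = p] of the zero sum
   [<S*^(k - p) b, h>] is minus the sum of the later ones. *)
Lemma Cmod_inner_sqr_le_tails k p :
  (p <= k)%nat -> (forall j, (k - p <= j < k)%nat -> ~ Lam j) ->
  Cmod (vinner (b k) (h p)) ^ 2 <= H2_sqnorm (fun j => b (k + S j)%nat) *
    Series (fun j => indicator (Lam (k + S j)%nat) * sqnorm (h (p + S j)%nat)).
Proof.
  intros Hpk gap.
  set (b' := fun j => b (k + S j)%nat). set (h' := fun j => h (p + S j)%nat).
  assert (Hb' : in_H2 b') by apply in_H2_tail, Hb.
  assert (Hh' : in_H2 h') by apply in_H2_tail, Hh.
  set (g := fun j => vscal (CR (indicator (Lam (k + S j)%nat))) (h' j)).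
  assert (Hg : in_H2 g) by apply (in_H2_indicator (fun j => Lam (k + S j)%nat)), Hh'.
  assert (first_term : C0 = Cadd (vinner (b k) (h p)) (H2_inner b' g)).
  { rewrite <- (orth (k - p)).
    rewrite (CSeries_first_term _ _ p (is_CSeries_inner _ _ (in_H2_bshift (k - p) b Hb) Hh)).
    - unfold bshift_iter. replace (p + (k - p))%nat with k by lia. f_equal.
      apply CSeries_ext. intros j. unfold g. rewrite inner_scalr. unfold b', h'.
      replace (p + S j + (k - p))%nat with (k + S j)%nat by lia.
      destruct (classic (Lam (k + S j)%nat)) as [mem | mem].
      + rewrite indicator_true by exact mem. Cring.
      + rewrite supp, inner_zerol by exact mem. Cring.
    - intros s Hs. unfold bshift_iter. rewrite supp by (apply gap; lia). apply inner_zerol. }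
  assert (Cmod_eq : Cmod (vinner (b k) (h p)) ^ 2 = Cmod (H2_inner b' g) ^ 2).
  { rewrite !Cmod_sqr. pose proof (f_equal Cre first_term). pose proof (f_equal Cim first_term).
    simpl in *. nra. }
  rewrite Cmod_eq. eapply Rle_trans; [exact (H2_cauchy_schwarz b' g Hb' Hg) |].
  right. f_equal. exact (H2_sqnorm_indicator (fun j => Lam (k + S j)%nat) h').
Qed.

Lemma sqnorm_le_gap_sum eps r k p :
  0 < eps -> (p <= r)%nat -> eps * vnorm (b k) <= Cmod (vinner (b k) (h p)) ->
  (r <= k)%nat -> (forall j, (k - r <= j < k)%nat -> ~ Lam j) -> Lam k ->
  sqnorm (b k) <=
    / eps ^ 2 * gap_sum Lam (window_sqnorm h r) k * H2_sqnorm (fun j => b (k + S j)%nat).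
Proof.
  intros Heps Hp norming Hrk gap Lk.
  set (tail := H2_sqnorm _). set (weight := gap_sum _ _ _).
  assert (tail_ge0 : 0 <= tail) by apply H2_sqnorm_ge0, in_H2_tail, Hb.
  assert (le_weight : Series (fun j => indicator (Lam (k + S j)%nat) * sqnorm (h (p + S j)%nat))
    <= weight).
  { apply Series_le.
    - intros j. pose proof (indicator_bounds (Lam (k + S j)%nat)) as ind_bounds. split.
      + apply Rmult_le_pos; [apply ind_bounds | apply sqnorm_ge0].
      + rewrite indicator_andl by exact Lk. apply Rmult_le_compat_l; [apply ind_bounds |].
        apply (sum_n_term_le (fun p => sqnorm (h (p + S j)%nat)));
          [intros i; apply sqnorm_ge0 | exact Hp].
    - apply ex_series_Rle with (window_sqnorm h r); [| apply ex_series_window_sqnorm, Hh].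
      intros j. apply indicator_mul_bounds, window_sqnorm_ge0. }
  assert (sqr : eps ^ 2 * sqnorm (b k) <= tail * weight).
  { rewrite <- vnorm_sqr, <- Rpow_mult_distr.
    eapply Rle_trans; [apply pow_incr; split; [| exact norming] |].
    - apply Rmult_le_pos; [lra | apply vnorm_ge0].
    - eapply Rle_trans; [apply Cmod_inner_sqr_le_tails; [lia |] |].
      + intros j Hj. apply gap. lia.
      + apply Rmult_le_compat_l; assumption. }
  apply Rmult_le_reg_l with (eps ^ 2); [nra |].
  replace (eps ^ 2 * (/ eps ^ 2 * weight * tail)) with (tail * weight) by (field; lra). exact sqr.
Qed.

Theorem eventually_zero_of_norming c eps r : 1 < c -> gap_ratio c Lam -> 0 < eps ->
  (forall k, exists p, (p <= r)%nat /\ eps * vnorm (b k) <= Cmod (vinner (b k) (h p))) ->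
  exists K, forall k, (K <= k)%nat -> b k = vzero.
Proof.
  intros Hc HLam Heps norming.
  destruct (gap_ratio_sparse Hc HLam r) as [K sparse].
  pose proof (window_sqnorm_ge0 h r) as window_ge0.
  pose proof (ex_series_window_sqnorm h r Hh) as window_sum.
  assert (weight_ge0 : forall k, 0 <= / eps ^ 2 * gap_sum Lam (window_sqnorm h r) k).
  { intros k. apply Rmult_le_pos; [apply Rlt_le, Rinv_0_lt_compat, pow_lt, Heps |].
    apply gap_sum_ge0; assumption. }
  destruct (eventually_zero_of_le_tail (fun k => sqnorm (b k)) _ (K + r)
    (fun k => sqnorm_ge0 (b k)) (proj1 (in_H2_ex_series b) Hb) weight_ge0) as [K' HK'].
  - apply (ex_series_scal_l (V := R_NormedModule)).
    exact (ex_series_gap_sum Lam _ window_ge0 window_sum c Hc HLam).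
  - intros k Hk. destruct (classic (Lam k)) as [Lk | Lk].
    + destruct (norming k) as (p & Hp & bound).
      apply (sqnorm_le_gap_sum eps r k p Heps Hp bound); [lia | | exact Lk].
      intros j Hj Lj. pose proof (sparse j k ltac:(lia) ltac:(lia) Lj Lk). lia.
    + rewrite supp, sqnorm_zero by exact Lk.
      apply Rmult_le_pos; [apply weight_ge0 | apply H2_sqnorm_ge0, in_H2_tail, Hb].
  - exists K'. intros k Hk. apply sqnorm_eq0, HK', Hk.
Qed.
End Correlation.

Theorem lacunary_orth_eq0 c (Lam : nat -> Prop) (a h : nat -> V) :
  1 < c -> gap_ratio c Lam -> in_H2 a -> in_H2 h -> (forall k, a k <> vzero -> Lam k) ->
  completely_rel_compact a -> (forall N, span_tail_full a N) ->
  (forall n, H2_inner (bshift_iter n a) h = C0) ->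
  forall p, h p = vzero.
Proof.
  intros Hc HLam Ha Hh supp comp span orth.
  destruct (orth_family_projection h) as (P & HP & Ph & Porth).
  destruct (completely_rel_compact_norming a h P comp HP Porth) as (eps & r & Heps & norming).
  destruct (eventually_zero_of_norming Lam (fun k => P (a k)) h) with (c := c) (eps := eps) (r := r)
    as [K HK]; auto.
  - apply in_H2_le with (fun k => sqnorm (a k)); [| apply in_H2_ex_series, Ha].
    intros k. apply orth_proj_sqnorm_le, HP.
  - intros k Hk. replace (a k) with (vzero : V); [apply orth_proj_zero, HP |].
    symmetry. apply NNPP. intros nz. apply Hk, supp, nz.
  - intros n. rewrite <- (orth n). apply CSeries_ext. intros k. apply Ph.
  - intros p. apply (orth_dense_span_eq0 (fun j => a (K + j)%nat)).
    + apply span_tail_full_closure, span.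
    + intros j. rewrite <- Ph, HK by lia. apply inner_zerol.
Qed.
End LacunaryOrthogonality.

(** * Coordinate shifts *)

Definition zshift {X : IPS} (g : nat -> X) (z : Z) (k : nat) : X := fhat g (Z.of_nat k + z).

Lemma zshift_nonneg {X : IPS} (g : nat -> X) z k :
  (0 <= Z.of_nat k + z)%Z -> zshift g z k = g (Z.to_nat (Z.of_nat k + z)).
Proof. intros H. unfold zshift, fhat. rewrite (proj2 (Z.ltb_ge _ _) H). reflexivity. Qed.

Lemma zshift_neg {X : IPS} (g : nat -> X) z k : (Z.of_nat k + z < 0)%Z -> zshift g z k = vzero.
Proof. intros H. unfold zshift, fhat. rewrite (proj2 (Z.ltb_lt _ _) H). reflexivity. Qed.

Lemma zshift_zshift_opp {X : IPS} (g : nat -> X) z k :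
  (0 <= Z.of_nat k + z)%Z -> zshift (zshift g (- z)) z k = g k.
Proof. intros H. rewrite !zshift_nonneg by lia. f_equal. lia. Qed.

Lemma zshift_bshift {X : IPS} (g : nat -> X) z n k :
  (0 <= Z.of_nat k + z)%Z -> zshift (bshift_iter n g) z k = zshift g z (k + n).
Proof. intros H. rewrite !zshift_nonneg by lia. unfold bshift_iter. f_equal. lia. Qed.

Lemma Fin_abs_bound d (m : Fin.t d -> Z) : exists M : nat, forall i, (Z.abs (m i) <= Z.of_nat M)%Z.
Proof.
  induction d.
  - exists 0%nat. intros i. exact (Fin.case0 (fun i => (Z.abs (m i) <= Z.of_nat 0)%Z) i).
  - destruct (IHd (fun i => m (Fin.FS i))) as [M HM].
    exists (M + Z.to_nat (Z.abs (m Fin.F1)))%nat. intros i.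
    apply (Fin.caseS' i); [lia |]. intros j. specialize (HM j). lia.
Qed.

Section IntegerShift.
Context {X : IPS} {HX : is_hilbert X}.

Lemma in_H2_zshift (F : nat -> X) z : in_H2 F -> in_H2 (zshift F z).
Proof.
  rewrite !in_H2_ex_series. intros HF. destruct (Z_le_gt_dec 0 z) as [Hz | Hz].
  - apply (ex_series_incr_n _ (Z.to_nat z)) in HF. eapply ex_series_ext; [| exact HF].
    intros k. simpl. rewrite zshift_nonneg by lia. do 2 f_equal. lia.
  - apply (ex_series_incr_n _ (Z.to_nat (- z))). eapply ex_series_ext; [| exact HF].
    intros k. simpl. rewrite zshift_nonneg by lia. do 2 f_equal. lia.
Qed.

Lemma sqnorm_zshift_le (F : nat -> X) z k : in_H2 F -> sqnorm (zshift F z k) <= H2_sqnorm F.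
Proof.
  intros HF. destruct (Z_lt_le_dec (Z.of_nat k + z) 0) as [H | H].
  - rewrite zshift_neg, sqnorm_zero by exact H. apply H2_sqnorm_ge0, HF.
  - rewrite zshift_nonneg by exact H. apply sqnorm_le_H2_sqnorm, HF.
Qed.

Lemma H2_inner_zshift (F G : nat -> X) z n M : (z <= Z.of_nat M)%Z ->
  H2_inner (bshift_iter n (zshift F z)) (zshift G (- (Z.of_nat M - z))) =
  H2_inner (bshift_iter (n + M) F) G.
Proof.
  intros HM. unfold H2_inner. rewrite (CSeries_drop_zeros _ (Z.to_nat (Z.of_nat M - z))).
  - apply CSeries_ext. intros s. unfold bshift_iter. rewrite !zshift_nonneg by lia.
    f_equal; f_equal; lia.
  - intros s Hs. rewrite (zshift_neg G) by lia. apply inner_zeror.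
Qed.
End IntegerShift.

Definition coord_shift {X : IPS} {d : nat} (F : nat -> powIPS X d) (m : Fin.t d -> Z) (k : nat) :
  powIPS X d := fun i => zshift (fun j => F j i) (m i) k.

Lemma coord_shift_opp {X : IPS} {d : nat} (F : nat -> powIPS X d) (m : Fin.t d -> Z) k :
  (forall i, 0 <= Z.of_nat k + m i)%Z -> coord_shift (coord_shift F (fun i => - m i)%Z) m k = F k.
Proof.
  intros H. apply functional_extensionality; intros i.
  exact (zshift_zshift_opp (fun j => F j i) (m i) k (H i)).
Qed.

Lemma coord_shift_support {X : IPS} {d : nat} (F : nat -> powIPS X d) (m : Fin.t d -> Z) Lam k :
  (forall i, spec_in_shift (fun j => F j i) Lam (m i)) -> coord_shift F m k <> vzero -> Lam k.
Proof.
  intros Hspec Hk.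
  assert (ex : exists i, coord_shift F m k i <> vzero).
  { apply NNPP; intros C. apply Hk. apply functional_extensionality; intros i.
    apply NNPP; intros Ci. apply C. exists i. exact Ci. }
  destruct ex as [i Hi]. unfold coord_shift in Hi.
  destruct (Z_lt_le_dec (Z.of_nat k + m i) 0) as [neg | nonneg];
    [rewrite zshift_neg in Hi by exact neg; congruence |].
  rewrite zshift_nonneg in Hi by exact nonneg.
  destruct (Hspec i _ Hi) as (l & Ll & El). replace k with l by lia. exact Ll.
Qed.

Section CoordinateShift.
Context {X : IPS} {HX : is_hilbert X} {d : nat}.

Lemma in_H2_coord (F : nat -> powIPS X d) i : in_H2 F -> in_H2 (fun k => F k i).
Proof.
  rewrite (in_H2_ex_series F). apply in_H2_le. intros k. apply sqnorm_coord_le.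
Qed.

Lemma in_H2_pow (F : nat -> powIPS X d) : (forall i, in_H2 (fun k => F k i)) -> in_H2 F.
Proof.
  intros H. apply in_H2_ex_series. eexists.
  apply (is_CSeries_finsum d (fun k i => vinner (F k i) (F k i)) _
           (fun i => is_CSeries_inner _ _ (H i) (H i))).
Qed.

Lemma H2_inner_pow (F G : nat -> powIPS X d) : in_H2 F -> in_H2 G ->
  H2_inner F G = finsum d (fun i => H2_inner (fun k => F k i) (fun k => G k i)).
Proof.
  intros HF HG. apply is_CSeries_unique, is_CSeries_finsum. intros i.
  apply is_CSeries_inner; apply in_H2_coord; assumption.
Qed.

Lemma in_H2_coord_shift (F : nat -> powIPS X d) m : in_H2 F -> in_H2 (coord_shift F m).
Proof. intros HF. apply in_H2_pow. intros i. apply in_H2_zshift, (in_H2_coord F i HF). Qed.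

Lemma sqnorm_coord_shift_le (F : nat -> powIPS X d) m k :
  in_H2 F -> sqnorm (coord_shift F m k) <= H2_sqnorm F.
Proof.
  intros HF. change (H2_sqnorm F) with (Cre (H2_inner F F)). rewrite H2_inner_pow by exact HF.
  apply finsum_re_le. intros i. exact (sqnorm_zshift_le _ (m i) k (in_H2_coord F i HF)).
Qed.

Lemma H2_inner_coord_shift (F G : nat -> powIPS X d) m n M :
  (forall i, m i <= Z.of_nat M)%Z -> in_H2 F -> in_H2 G ->
  H2_inner (bshift_iter n (coord_shift F m)) (coord_shift G (fun i => - (Z.of_nat M - m i))%Z) =
  H2_inner (bshift_iter (n + M) F) G.
Proof.
  intros HM HF HG.
  rewrite !H2_inner_pow by
    (try apply in_H2_bshift; try apply in_H2_coord_shift; assumption).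
  f_equal. apply functional_extensionality; intros i.
  exact (H2_inner_zshift (fun k => F k i) (fun k => G k i) (m i) n M (HM i)).
Qed.

Lemma coord_shift_sub_bshifts (f G : nat -> powIPS X d) m P c k :
  (forall i, 0 <= Z.of_nat k + m i)%Z ->
  coord_shift (fun j => vsub (G j) (vsum P (fun n => vscal (c n) (bshift_iter n f j)))) m k =
  vsub (coord_shift G m k) (vsum P (fun n => vscal (c n) (coord_shift f m (k + n)))).
Proof.
  intros H. apply functional_extensionality; intros i. specialize (H i).
  unfold coord_shift at 1. rewrite zshift_nonneg by exact H. unfold vsub; simpl.
  rewrite !vsum_coord. f_equal.
  - unfold coord_shift. rewrite zshift_nonneg by exact H. reflexivity.
  - f_equal. apply vsum_ext. intros n _. simpl. f_equal.
    unfold coord_shift. rewrite <- zshift_bshift, zshift_nonneg by exact H. reflexivity.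
Qed.

Theorem cyclic_span_tail_full (f : nat -> powIPS X d) (m : Fin.t d -> Z) N :
  cyclic_bshift f -> span_tail_full (coord_shift f m) N.
Proof.
  intros cyc. apply span_tail_full_closure. intros y eps He.
  destruct (Fin_abs_bound d m) as [M0 HM0]. set (M := (N + M0)%nat).
  assert (HM : forall i, (0 <= Z.of_nat M + m i)%Z) by (intros i; specialize (HM0 i); lia).
  set (delta := (fun k => if (k =? M)%nat then y else vzero) : nat -> powIPS X d).
  set (G := coord_shift delta (fun i => - m i)%Z).
  assert (HG : in_H2 G).
  { apply in_H2_coord_shift, in_H2_ex_series, (ex_series_incr_n _ (S M)).
    apply ex_series_ext with (fun _ => 0); [| exists 0; exact is_series_zero].
    intros k. unfold delta. rewrite (proj2 (Nat.eqb_neq _ _)) by lia. symmetry. apply sqnorm_zero. }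
  destruct (cyc G HG eps He) as (P & c & Hdist).
  apply H2_dist_lt_iff in Hdist. destruct Hdist as [HD Hlt].
  exists (vsum P (fun n => vscal (c n) (coord_shift f m (M + n)))). split.
  - pose proof (lin_span_subspace (fun j => coord_shift f m (N + j)%nat)) as HS.
    apply subspace_vsum; [exact HS |]. intros n. apply HS.
    unfold M. rewrite <- Nat.add_assoc. apply (lin_span_mem (fun j => coord_shift f m (N + j)%nat)).
  - apply vnorm_lt; [lra |]. eapply Rle_lt_trans; [| exact Hlt].
    replace y with (coord_shift G m M).
    + rewrite <- coord_shift_sub_bshifts by exact HM. apply sqnorm_coord_shift_le, HD.
    + unfold G. rewrite coord_shift_opp by exact HM.
      unfold delta. rewrite Nat.eqb_refl. reflexivity.
Qed.

(* The coordinates of [h] are shifted by [m i - M], not by [m i]: the latter would discard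
   coefficients where [m i > 0]. *)
Theorem span_tail_full_cyclic (Lam : nat -> Prop) (f : nat -> powIPS X d) (m : Fin.t d -> Z) :
  lacunary_infinite Lam -> in_H2 f -> (forall i, spec_in_shift (fun j => f j i) Lam (m i)) ->
  completely_rel_compact (coord_shift f m) ->
  (forall N, span_tail_full (coord_shift f m) N) -> cyclic_bshift f.
Proof.
  intros HLam Hf Hspec Hcomp Hspan.
  destruct (lacunary_gap_ratio Lam HLam) as (c & Hc & ratio).
  destruct (Fin_abs_bound d m) as [M HM].
  assert (HM' : forall i, (m i <= Z.of_nat M)%Z) by (intros i; specialize (HM i); lia).
  apply cyclic_bshift_of_orth_eq0; [exact Hf |]. intros h Hh orth k.
  set (h' := coord_shift h (fun i => - (Z.of_nat M - m i))%Z).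
  assert (h'0 : forall p, h' p = vzero).
  { apply (lacunary_orth_eq0 c Lam (coord_shift f m)); auto.
    - apply in_H2_coord_shift, Hf.
    - apply in_H2_coord_shift, Hh.
    - intros j. apply coord_shift_support, Hspec.
    - intros n. unfold h'. rewrite H2_inner_coord_shift by assumption. apply orth. }
  rewrite <- (coord_shift_opp h (fun i => Z.of_nat M - m i)%Z k)
    by (intros i; specialize (HM' i); lia).
  fold h'. rewrite (functional_extensionality h' (fun _ => vzero) h'0).
  apply functional_extensionality; intros i. specialize (HM' i).
  unfold coord_shift. rewrite zshift_nonneg by lia. reflexivity.
Qed.
End CoordinateShift.

Theorem mainTheorem13 (X : IPS) (HX : is_hilbert X) (Hsep : separable X)
  (Lam : nat -> Prop) (HLam : lacunary_infinite Lam)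
  (d : nat) (m : Fin.t d -> Z)
  (f : nat -> powIPS X d) (Hf : in_H2 f)
  (Hspec : forall i : Fin.t d, spec_in_shift (fun j => f j i) Lam (m i))
  (Hcomp : completely_rel_compact
             (fun k : nat => (fun i : Fin.t d =>
                 fhat (fun j => f j i) (Z.of_nat k + m i)%Z) : powIPS X d)) :
  cyclic_bshift f <->
  (forall N : nat,
     span_tail_full
       (fun k : nat => (fun i : Fin.t d =>
           fhat (fun j => f j i) (Z.of_nat k + m i)%Z) : powIPS X d) N).
Proof.
  split.
  - intros cyc N. exact (cyclic_span_tail_full f m N cyc).
  - exact (span_tail_full_cyclic Lam f m HLam Hf Hspec Hcomp).
Qed.
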